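(* For $\varepsilon>0$ let $(u_1^\varepsilon,\dots,u_m^\varepsilon)$ be the nonnegative solution of $$\Delta u_i^\varepsilon=\frac1\varepsilon\prod_{j=1}^m u_j^\varepsilon\ \text{ in }\Omega,\qquad u_i^\varepsilon=\phi_i\ \text{ on }\partial\Omega,\qquad i=1,\dots,m.$$ Let $w_i$, $i=1,\dots,m-1$, be the harmonic function in $\Omega$ with boundary values $\phi_1-\phi_{i+1}$ on $\partial\Omega$, and let $$u_1(x)=\max\Big(\max_{i=1,\dots,m-1}w_i(x),\,0\Big).$$ Then there is a constant $C$ independent of $\varepsilon$ such that $$\|u_1^\varepsilon-u_1\|_{L^{m+1}(\Omega)}\le C\,\varepsilon^{1/(m+1)}.$$
   Context: $\Omega\subset\mathbb{R}^n$ is a bounded domain with $C^{1,\alpha}$ boundary (for a Hölder exponent $\alpha\in(0,1)$) and $m$ is the number of components. The boundary data $\phi_1,\dots,\phi_m$ are nonnegative $C^{1,\alpha}$ functions on $\partial\Omega$ with $\prod_{i=1}^m\phi_i=0$ on $\partial\Omega$. Solutions are nonnegative weak solutions in $H^1(\Omega)^m\cap L^\infty(\Omega)^m$. *)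

(* Defs.v *)
From HB Require Import structures.
From mathcomp Require Import all_boot all_order all_algebra.
From mathcomp Require Import all_classical all_reals all_analysis.

Set Implicit Arguments.
Unset Strict Implicit.
Unset Printing Implicit Defensive.

Import Order.TTheory GRing.Theory Num.Theory.
Import numFieldNormedType.Exports.

Local Open Scope classical_set_scope.
Local Open Scope ring_scope.

(* R^n is ['rV[R]_n]. Its library norm is the sup norm, which is equivalent to
   the Euclidean one and is only used below for balls, boundedness and Hölder
   conditions. *)

Definition rV_display : measure_display. Proof. exact: default_measure_display. Qed.

(* The product sigma-algebra, i.e. the Borel one, as in the library's instance
   on [n.-tuple T]. *)
Section measurable_rV.
Context {R : realType} {n : nat}.

Definition rV_coord (i : 'I_n) (x : 'rV[R]_n) : R := x ord0 i.

Let rV_set0 : g_sigma_preimage rV_coord set0.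
Proof. exact: sigma_algebra0. Qed.

Let rV_setC A : g_sigma_preimage rV_coord A -> g_sigma_preimage rV_coord (~` A).
Proof. exact: sigma_algebraC. Qed.

Let rV_bigcup (F : _^nat) : (forall i, g_sigma_preimage rV_coord (F i)) ->
  g_sigma_preimage rV_coord (\bigcup_i (F i)).
Proof. exact: sigma_algebra_bigcup. Qed.

HB.instance Definition _ := @isMeasurable.Build rV_display
  'rV[R]_n (g_sigma_preimage rV_coord) rV_set0 rV_setC rV_bigcup.

End measurable_rV.

Section measurable_fun_rV.
Context {R : realType} {n : nat}.

Lemma measurable_rV_coord (i : 'I_n) :
  measurable_fun [set: 'rV[R]_n] (@rV_coord R n i).
Proof.
move=> _ Y mY; rewrite setTI; apply: sub_sigma_algebra => /=.
rewrite -bigcup_seq/=; exists i => /=; first by rewrite mem_index_enum.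
by exists Y => //; rewrite setTI.
Qed.

Lemma measurable_fun_rVP d (T : measurableType d) (f : T -> 'rV[R]_n) :
  (forall i, measurable_fun setT (rV_coord i \o f)) -> measurable_fun setT f.
Proof.
move=> mf; apply: (@measurability _ _ _ _ setT f
  (\big[setU/set0]_(i < n) preimage_set_system setT (@rV_coord R n i) measurable)) => //.
move=> _ [B + <-]; rewrite -bigcup_seq => -[i _ [A mA <-]].
by have := mf i measurableT A mA; rewrite !setTI.
Qed.

End measurable_fun_rV.

Section rV_cons.
Context {R : realType} {n : nat}.

Definition rV_cons (p : R * 'rV[R]_n) : 'rV[R]_n.+1 :=
  \row_i if unlift ord0 i is Some j then p.2 ord0 j else p.1.

Definition rV_head (x : 'rV[R]_n.+1) : R := x ord0 ord0.
Definition rV_tail (x : 'rV[R]_n.+1) : 'rV[R]_n := col' ord0 x.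

Lemma rV_cons0 p : rV_cons p ord0 ord0 = p.1.
Proof. by rewrite mxE unlift_none. Qed.

Lemma rV_consS p i : rV_cons p ord0 (lift ord0 i) = p.2 ord0 i.
Proof. by rewrite mxE liftK. Qed.

Lemma measurable_rV_cons : measurable_fun setT rV_cons.
Proof.
apply: measurable_fun_rVP => i; have [j ->|->] := unliftP ord0 i.
  rewrite (_ : _ \o _ = rV_coord j \o snd); last first.
    by apply/funext => p /=; rewrite /rV_coord rV_consS.
  by apply: measurableT_comp => //; exact: measurable_rV_coord.
rewrite (_ : _ \o _ = fst) //.
by apply/funext => p /=; rewrite /rV_coord rV_cons0.
Qed.

Lemma measurable_rV_tail : measurable_fun setT rV_tail.
Proof.
apply: measurable_fun_rVP => i.
rewrite (_ : _ \o _ = rV_coord (lift ord0 i)); last first.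
  by apply/funext => x; rewrite /rV_coord /rV_tail /= mxE.
exact: measurable_rV_coord.
Qed.

Lemma rV_consK : cancel rV_cons (fun x => (rV_head x, rV_tail x)).
Proof.
move=> p; rewrite /rV_head rV_cons0; case: p => a y /=; congr pair.
by apply/rowP => i; rewrite mxE rV_consS.
Qed.

Lemma measurable_rV_uncons :
  measurable_fun setT (fun x : 'rV[R]_n.+1 => (rV_head x, rV_tail x)).
Proof.
apply: measurable_fun_pair; last exact: measurable_rV_tail.
exact: (measurable_rV_coord ord0).
Qed.

End rV_cons.

Section lebesgue_rV.
Context {R : realType}.

Section lebesgue_rV0.

Definition lebesgue_rV0 : set 'rV[R]_0 -> \bar R := \d_ (0 : 'rV[R]_0).
HB.instance Definition _ := Measure.on lebesgue_rV0.

Let lebesgue_rV0_sigma_finite : sigma_finite setT lebesgue_rV0.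
Proof.
exists (fun=> setT); first by rewrite bigcup_const//; exists 0%N.
move=> _; split => //.
by rewrite /lebesgue_rV0 diracT ltry.
Qed.

HB.instance Definition _ := Measure_isSigmaFinite.Build _ _ _ lebesgue_rV0
  lebesgue_rV0_sigma_finite.

End lebesgue_rV0.

Section lebesgue_rVS.
Variables (n : nat) (mu : {sigma_finite_measure set 'rV[R]_n -> \bar R}).

Definition lebesgue_rVS : set 'rV[R]_n.+1 -> \bar R :=
  pushforward (@lebesgue_measure R \x mu)%E rV_cons.

Let lebesgue_rVS_measure : {measure set 'rV[R]_n.+1 -> \bar R} :=
  measure_function_pushforward__canonical__measure_function_Measure
    (@lebesgue_measure R \x mu)%E measurable_rV_cons.

HB.instance Definition _ := isMeasure.Build _ _ _ lebesgue_rVS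
  (measure0 lebesgue_rVS_measure) (measure_ge0 lebesgue_rVS_measure)
  (@measure_semi_sigma_additive _ _ _ lebesgue_rVS_measure).

Let lebesgue_rVS_sigma_finite : sigma_finite setT lebesgue_rVS.
Proof.
have /sigma_finiteP[F [FT ndF Foo]] := sigma_finiteT (@lebesgue_measure R).
have /sigma_finiteP[G [GT ndG Goo]] := sigma_finiteT mu.
pose H k := (fun x : 'rV[R]_n.+1 => (rV_head x, rV_tail x)) @^-1` (F k `*` G k).
have HE k : rV_cons @^-1` H k = F k `*` G k.
  rewrite /H -comp_preimage [X in X @^-1` _](_ : _ = id) //.
  by apply/funext => p; exact: rV_consK.
exists H.
  apply/esym; rewrite -subTset => x _.
  have [i _ Fi] : (\bigcup_k F k) (rV_head x) by rewrite -FT.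
  have [j _ Gj] : (\bigcup_k G k) (rV_tail x) by rewrite -GT.
  exists (maxn i j) => //; split => /=.
    by move: Fi; exact/subsetPset/ndF/leq_maxl.
  by move: Gj; exact/subsetPset/ndG/leq_maxr.
move=> k; have [mF Fk] := Foo k; have [mG Gk] := Goo k; split.
  by rewrite -[X in measurable X]setTI; apply: measurable_rV_uncons => //;
    exact: measurableX.
rewrite /lebesgue_rVS /pushforward HE product_measure1E//.
by rewrite lte_mul_pinfty// ge0_fin_numE.
Qed.

HB.instance Definition _ := Measure_isSigmaFinite.Build _ _ _ lebesgue_rVS
  lebesgue_rVS_sigma_finite.

End lebesgue_rVS.

(* The n-fold product of the Lebesgue measure of R. *)
Fixpoint lebesgue_rV (n : nat) : {sigma_finite_measure set 'rV[R]_n -> \bar R} :=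
  match n with
  | 0 => lebesgue_rV0
  | n'.+1 => lebesgue_rVS (lebesgue_rV n')
  end.

End lebesgue_rV.
Arguments lebesgue_rV {R} n.

Section classical.
Context {R : realType} {n : nat}.
Implicit Types (f : 'rV[R]_n -> R) (A : set 'rV[R]_n).

Definition partial (i : 'I_n) f : 'rV[R]_n -> R :=
  'D_(delta_mx ord0 i : 'rV[R]_n) f.

Definition C1_on A f := forall x, A x ->
  differentiable f x /\ forall i, {for x, continuous (partial i f)}.

Definition C2_on A f := C1_on A f /\ forall i, C1_on A (partial i f).

Definition laplacian f x : R := \sum_(i < n) partial i (partial i f) x.

(* Harmonic functions are meant in the classical sense, [A] being open. *)
Definition harmonic_on A f := C2_on A f /\ forall x, A x -> laplacian f x = 0.

Definition holder (alpha : R) f :=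
  exists M : R, forall x y, `|f x - f y| <= M * `|x - y| `^ alpha.

Definition C1_holder (alpha : R) f :=
  C1_on setT f /\ forall i, holder alpha (partial i f).

Definition bdry A : set 'rV[R]_n := closure A `\` interior A.

Definition bounded_domain A :=
  [/\ open A, connected A, A !=set0 & bounded_set A].

(* f is of class C^{1,alpha} on the boundary of A when it is the restriction
   of a C^{1,alpha} function on the whole space. *)
Definition C1_holder_bdry (alpha : R) A f :=
  exists Phi, C1_holder alpha Phi /\ forall x, bdry A x -> Phi x = f x.

End classical.

(* Near each boundary point, after singling out a coordinate axis [j] and
   possibly reversing it, the open set is the part of a ball lying above the
   graph of a C^{1,alpha} function of the n other coordinates. *)
Definition C1_holder_boundary {R : realType} {n : nat} (alpha : R)
    (A : set 'rV[R]_n.+1) :=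
  forall x0, bdry A x0 ->
  exists (r : R) (j : 'I_n.+1) (s : bool) (gamma : 'rV[R]_n -> R),
    [/\ 0 < r, C1_holder alpha gamma &
        forall x, ball x0 r x ->
          (A x <-> gamma (col' j x) < (-1) ^+ s * x ord0 j)].

(* Functions on the open set [A] are total functions of which only the values
   on [A] matter: integrals are over [A], and [f \_ A] is [f] extended by 0
   outside [A]. Test functions are taken in C^1_c, as in the books by
   Gilbarg-Trudinger and by Brezis; by mollification C^oo_c gives the same
   notions. *)

Section sobolev.
Context {R : realType} {n : nat}.
Implicit Types (f u psi : 'rV[R]_n -> R) (A : set 'rV[R]_n) (p : \bar R).
Local Notation mu := (lebesgue_rV n).

Definition in_Lp p A f := f \_ A \in Lfun mu p.

Definition Lp_norm p A f : \bar R := Lnorm mu p (EFin \o (f \_ A)).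

Definition test_fun A psi := C1_on setT psi /\
  exists K, [/\ compact K, K `<=` A & forall x, ~ K x -> psi x = 0].

Definition H1_grad A u (G : 'I_n -> 'rV[R]_n -> R) :=
  [/\ in_Lp 2%:E A u, forall i, in_Lp 2%:E A (G i) &
      forall i psi, test_fun A psi ->
        \int[mu]_(x in A) (u x * partial i psi x) =
        - \int[mu]_(x in A) (G i x * psi x)].

Definition H1 A u := exists G, H1_grad A u G.

(* H^1_0: the closure of the test functions in H^1 *)
Definition H1_0 A u := exists2 G, H1_grad A u G &
  forall e : R, 0 < e -> exists psi,
    [/\ test_fun A psi,
        (Lp_norm 2%:E A (u \- psi)%R < e%:E)%E &
        forall i, (Lp_norm 2%:E A (G i \- partial i psi)%R < e%:E)%E].

(* u = phi on the boundary of A in the sense of traces: u - Phi lies in H^1_0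
   for a C^1 extension Phi of phi (the choice of Phi is immaterial). *)
Definition trace_eq A u (phi : 'rV[R]_n -> R) := exists Phi,
  [/\ C1_on setT Phi, forall x, bdry A x -> Phi x = phi x & H1_0 A (u \- Phi)].

(* The weak form of Delta u = f. *)
Definition weak_laplacian A u f := exists2 G, H1_grad A u G &
  forall psi, test_fun A psi ->
    \sum_(i < n) \int[mu]_(x in A) (G i x * partial i psi x) =
    - \int[mu]_(x in A) (f x * psi x).

(* Nonnegative weak solutions of the system
   Delta u_i = eps^-1 prod_j u_j in A, u_i = phi_i on the boundary of A. *)
Definition segregation_solution (m : nat) A (eps : R)
    (phi u : 'I_m -> 'rV[R]_n -> R) := forall i,
  [/\ H1 A (u i), in_Lp +oo%E A (u i),
      {ae mu, forall x, A x -> 0 <= u i x},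
      weak_laplacian A (u i) (fun x => eps^-1 * \prod_(j < m) u j x) &
      trace_eq A (u i) (phi i)].

End sobolev.

(* The 0 of the big operator makes this max (max_i w_i) 0, and 0 if k = 0. *)
Definition max_plus {R : realType} {T : Type} (k : nat) (w : 'I_k -> T -> R)
    (x : T) : R := \big[Num.max/0]_(i < k) w i x.

(* Main.v *)
Require Import Defs.
From HB Require Import structures.
From mathcomp Require Import all_boot all_order all_algebra.
From mathcomp Require Import all_classical all_reals all_analysis.
From mathcomp Require Import measurable_realfun ess_sup_inf.
From mathcomp Require Import ring lra.

Set Implicit Arguments.
Unset Strict Implicit.
Unset Printing Implicit Defensive.

Import Order.TTheory GRing.Theory Num.Theory.
Import numFieldNormedType.Exports.

Local Open Scope classical_set_scope.
Local Open Scope ring_scope.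

(* The differences u_1 - u_(i+1) are weakly harmonic with the boundary values of
   w_i, hence equal w_i almost everywhere. Since the u_j are nonnegative, this
   gives u_1 - U <= u_j for all j, where U = max (max_i w_i) 0, and thus
   (u_1 - U)^(m+1) <= (u_1 - U) * prod_j u_j.  On the boundary U = phi_1, because
   some phi_j vanishes there, so u_1 - U is an admissible test function for the
   equation of u_1, and
     1/eps * int (u_1 - U) prod_j u_j = - int grad u_1 . grad (u_1 - U)
       <= 1/2 int |grad U|^2 <= 1/2 sum_i int |grad w_i|^2,
   which does not depend on eps.

   No chain rule for Sobolev functions is needed: u is replaced by a C^1
   function P with the same boundary values that is close to it in H^1, and the
   tests are made with a C^1 truncation of P - w (resp. of P minus a smoothed
   maximum) which vanishes where |P - w| is small, hence near the boundary. *)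

(** The obstacle is that [w i] is only known to be continuous up to the boundary: nothing says a
    priori that its Dirichlet energy is finite or that it may enter a weak formulation. Finiteness
    is recovered from the solution itself. Once u_1 - u_(i+1) = w_i almost everywhere, the classical
    gradient of [w i] is the weak gradient of an H^1 function, hence square integrable. So the
    constant, a power of half the sum of these energies, can be written down before any solution is
    given. Limits are replaced by estimates with explicit errors. The approximation, the truncation
    level and the smoothing width are governed by one small parameter; gradient terms are handled by
    pointwise quadratic inequalities that hold because the derivative of the truncation stays in
    [0, 1]. R^n carries the sigma-algebra generated by the coordinates and the iterated product
    measure. Integration by parts therefore comes from Fubini and the one-dimensional fundamental
    theorem, and measurability of open sets from a countable family of C^1 bumps. *)

Section C1_calculus.
Context {R : realType} {n : nat}.
Implicit Types (f g : 'rV[R]_n -> R) (A : set 'rV[R]_n).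

Lemma near_differentiable f g x :
  {near x, f =1 g} -> differentiable f x -> differentiable g x.
Proof.
move=> fg df; have fgx : f x = g x by exact: (nbhs_singleton fg).
have [dfc /eqaddoP dfE] := (diff_locallyP _ _).1 df.
have gE : g \o shift x = cst (g x) + 'd f x +o_ 0 id.
  apply/eqaddoP => _/posnumP[e]; near=> h.
  have fh : (f \o shift x) h = (g \o shift x) h.
    near: h; have : \forall y \near x, f y = g y by [].
    rewrite (near_shift (0 : 'rV[R]_n)) /=.
    by apply: filterS => h /=; rewrite subr0.
  rewrite [X in `|X|](_ : _ = (f \o shift x - (cst (f x) + 'd f x)) h).
    by near: h; exact: dfE.
  by rewrite -[LHS]/(((g \o shift x) h) - (g x + 'd f x h)) -fh -fgx.
apply/diff_locallyP; rewrite (diff_unique _ gE)//.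
Unshelve. all: by end_near. Qed.

Lemma partialD i f g x : differentiable f x -> differentiable g x ->
  partial i (f \+ g) x = partial i f x + partial i g x.
Proof. by move=> df dg; apply: deriveD; exact: diff_derivable. Qed.

Lemma partialB i f g x : differentiable f x -> differentiable g x ->
  partial i (f \- g) x = partial i f x - partial i g x.
Proof. by move=> df dg; apply: deriveB; exact: diff_derivable. Qed.

Lemma partialM i f g x : differentiable f x -> differentiable g x ->
  partial i (f \* g) x = f x * partial i g x + g x * partial i f x.
Proof. by move=> df dg; apply: deriveM; exact: diff_derivable. Qed.

Lemma partial_cst i c x : partial i (cst c : 'rV[R]_n -> R) x = 0.
Proof. exact: derive_cst. Qed.

Lemma partial_coord i j (x : 'rV[R]_n) :
  partial i (fun y : 'rV[R]_n => y ord0 j) x = (i == j)%:R.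
Proof.
have di : derivable (id : 'rV[R]_n -> 'rV[R]_n) x (delta_mx ord0 i) by [].
have := derive_mx di; rewrite derive_id => /matrixP/(_ ord0 j).
by rewrite !mxE eqxx eq_sym => ->.
Qed.

Lemma partial_comp i (h : R -> R) dh f x :
  is_derive (f x) 1 h dh -> differentiable f x ->
  partial i (h \o f) x = dh * partial i f x.
Proof.
move=> [/derivable1_diffP hh hE] df.
rewrite /partial deriveE; last exact: differentiable_comp.
rewrite diff_comp//= deriveE//.
by rewrite diff1E// derive1E hE mulrC.
Qed.

Lemma near_eq_partial i f g x : {near x, f =1 g} -> partial i f x = partial i g x.
Proof. exact: near_eq_derive. Qed.

Lemma C1_on_eq A f g : open A -> {in A, f =1 g} -> C1_on A f -> C1_on A g.
Proof.
move=> oA fg cf x Ax; have [df cpf] := cf x Ax.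
have nfg : {near x, f =1 g}.
  by near=> y; apply: fg; rewrite inE; near: y; exact: open_nbhs_nbhs.
split; first exact: near_differentiable df.
move=> i; have pfg : {near x, partial i f =1 partial i g}.
  near=> y; apply: near_eq_partial; near=> z.
  by apply: fg; rewrite inE; near: z; apply: open_nbhs_nbhs; split => //;
   near: y; exact: open_nbhs_nbhs.
suff : partial i g y @[y --> x] --> partial i f x by rewrite (near_eq_partial i nfg).
apply: cvg_trans (cpf i); apply: (@near_eq_cvg _ _ (nbhs x)).
by apply: filterS pfg => y ->.
Unshelve. all: by end_near. Qed.

Lemma C1_on_sub A B f : A `<=` B -> C1_on B f -> C1_on A f.
Proof. by move=> AB cf x /AB /cf. Qed.

(** The rules of calculus compute [partial i f] only at points of [A]. As [A] is open, agreement on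
    [A] is agreement near each of its points, so continuity of the formula [p] carries over. *)
Lemma C1_on_partial_eq A i f p : open A -> (forall x, A x -> partial i f x = p x) ->
  (forall x, A x -> {for x, continuous p}) ->
  forall x, A x -> {for x, continuous (partial i f)}.
Proof.
move=> oA fp cp x Ax; suff : partial i f y @[y --> x] --> p x by rewrite -(fp x Ax).
apply: cvg_trans (cp x Ax); apply: (@near_eq_cvg _ _ (nbhs x)); near=> y.
by apply/esym; apply: fp; near: y; exact: open_nbhs_nbhs.
Unshelve. all: by end_near. Qed.

Lemma C1_on_cst A c : C1_on A (cst c).
Proof.
move=> x Ax; split => // i; rewrite (_ : partial i _ = cst 0); first exact: cst_continuous.
by apply/funext => y; rewrite partial_cst.
Qed.

Lemma C1_on_coord A j : C1_on A (fun y : 'rV[R]_n => y ord0 j).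
Proof.
move=> x Ax; split; first exact: differentiable_coord.
move=> i; rewrite (_ : partial i _ = cst (i == j)%:R); first exact: cst_continuous.
by apply/funext => y; rewrite partial_coord.
Qed.

Lemma C1_on_continuous A f x : C1_on A f -> A x -> {for x, continuous f}.
Proof. by move=> cf /cf[/differentiable_continuous]. Qed.

Lemma C1_onD A f g : open A -> C1_on A f -> C1_on A g -> C1_on A (f \+ g).
Proof.
move=> oA cf cg x Ax; have [df pf] := cf x Ax; have [dg pg] := cg x Ax.
split; first exact: differentiableD.
move=> i; apply: (@C1_on_partial_eq A _ _ (partial i f \+ partial i g)) => //.
  by move=> y Ay; rewrite partialD//; [case: (cf y Ay)|case: (cg y Ay)].
move=> y Ay; have [_ cfy] := cf y Ay; have [_ cgy] := cg y Ay.
exact: (continuousD (cfy i) (cgy i)).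
Qed.

Lemma C1_onM A f g : open A -> C1_on A f -> C1_on A g -> C1_on A (f \* g).
Proof.
move=> oA cf cg x Ax; have [df pf] := cf x Ax; have [dg pg] := cg x Ax.
split; first exact: differentiableM.
move=> i; apply: (@C1_on_partial_eq A _ _ (f \* partial i g \+ g \* partial i f)) => //.
  by move=> y Ay; rewrite partialM//; [case: (cf y Ay)|case: (cg y Ay)].
move=> y Ay; have cfy := C1_on_continuous cf Ay; have cgy := C1_on_continuous cg Ay.
have [_ pfy] := cf y Ay; have [_ pgy] := cg y Ay.
exact: (continuousD (continuousM cfy (pgy i)) (continuousM cgy (pfy i))).
Qed.

Lemma C1_on_comp A (h h' : R -> R) f : open A ->
  (forall t : R, is_derive t 1 h (h' t)) -> continuous h' ->
  C1_on A f -> C1_on A (h \o f).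
Proof.
move=> oA hh ch' cf x Ax; have [df pf] := cf x Ax.
split.
  by apply: differentiable_comp => //; apply/derivable1_diffP; case: (hh (f x)).
move=> i; apply: (@C1_on_partial_eq A _ _ ((h' \o f) \* partial i f)) => //.
  by move=> y Ay; rewrite (@partial_comp _ _ (h' (f y)))//; case: (cf y Ay).
move=> y Ay; have [_ pfy] := cf y Ay.
apply: continuousM (pfy i).
by apply: continuous_comp; [exact: C1_on_continuous cf Ay|exact: ch'].
Qed.

Lemma C1_onB A f g : open A -> C1_on A f -> C1_on A g -> C1_on A (f \- g).
Proof.
move=> oA cf cg.
rewrite (_ : _ \- _ = f \+ (cst (-1) \* g)); last first.
  by apply/funext => x /=; rewrite mulN1r.
exact: C1_onD cf (C1_onM oA (C1_on_cst (-1)) cg).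
Qed.

(** A point outside [A] has the complement of [K] as a neighbourhood, where the extension is
    identically 0; at a point of [A] nothing changes locally. *)
Lemma C1_on_patch A K f : open A -> closed K -> K `<=` A ->
  (forall x, A x -> ~ K x -> f x = 0) -> C1_on A f -> C1_on setT (f \_ A).
Proof.
move=> oA cK KA f0 cf x _; have [Ax|nAx] := pselect (A x).
  have : C1_on A (f \_ A).
    by apply: C1_on_eq cf => // y yA; rewrite patchE yA.
  exact.
have nKx : (~` K) x by move=> /KA.
have : C1_on (~` K) (f \_ A).
  apply: (@C1_on_eq _ (cst 0)); [exact: closed_openC| |exact: C1_on_cst].
  move=> y; rewrite inE => nKy; rewrite patchE; case: ifPn => //.
  by rewrite inE => Ay; rewrite f0.
exact.
Qed.

End C1_calculus.

(** * C^1 approximations of the positive part and of the identity *)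

Section truncation.
Context {R : realType}.
Implicit Types (d k t : R).

(** C^1 with a piecewise linear derivative. It is the one nonlinearity behind [softplus], [trunc]
    and [bump], which keeps their derivatives explicit. *)
Definition pos_sqr t := (Num.max 0 t) ^+ 2.

Lemma is_derive_pos_sqr t : is_derive t 1 pos_sqr (2 * Num.max 0 t).
Proof.
set l := 2 * Num.max 0 t.
have cl : h^-1 *: (pos_sqr (h *: (1 : R) + t) - pos_sqr t) @[h --> 0^'] --> l.
  apply/cvgrPdist_le => /= e e0; near=> h.
  have h0 : h != 0 by near: h; exact: nbhs_dnbhs_neq.
  have he : `|h| <= e by near: h; exact: dnbhs0_le.
  have hh : 0 < `|h| by rewrite normr_gt0.
  rewrite [X in `|X|](_ : _ = (l * h - (pos_sqr (h + t) - pos_sqr t)) / h); last first.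
    rewrite mulrBl mulfK// /GRing.scale/= mulr1 [in RHS]mulrC//.
  (* The first-order remainder of [pos_sqr] is at most [h ^+ 2] in each of the four sign cases for
     [t] and [h + t]. *)
  rewrite normrM normfV ler_pdivrMr// (@le_trans _ _ (`|h| * `|h|)) ?ler_wpM2r//.
  have -> : `|h| * `|h| = h ^+ 2 by rewrite -normrM -expr2 ger0_norm ?sqr_ge0.
  rewrite /l /pos_sqr ler_norml.
  by have [?|?] := leP t 0; have [?|?] := leP (h + t) 0; apply/andP; split; nra.
by apply: DeriveDef; [apply/cvg_ex; exists l|exact: cvg_lim cl].
Unshelve. all: end_near. Qed.

(** The primitive of the ramp rising linearly from 0 to 1 on [0, d]: a C^1 version of the positive
    part. It is identically 0 for t <= 0, which is what later produces compact supports. *)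
Definition softplus d t := (pos_sqr t - pos_sqr (t - d)) / (2 * d).

Definition dsoftplus d t := (Num.max 0 t - Num.max 0 (t - d)) / d.

Lemma is_derive_softplus d t : d != 0 ->
  is_derive t 1 (softplus d) (dsoftplus d t).
Proof.
move=> d0; have ds := is_derive_pos_sqr.
have dB : is_derive t (1 : R) (fun t => t - d) 1.
  by apply: is_derive_eq; rewrite subr0.
have dd := @is_derive1_comp _ pos_sqr (fun t => t - d) t _ _ (ds _) dB.
have -> : softplus d = (2 * d)^-1 *: (pos_sqr - (pos_sqr \o (fun t => t - d))).
  by apply/funext => x; rewrite /softplus [LHS]mulrC.
have dk := is_deriveZ ((2 * d)^-1) (is_deriveB (ds t) dd).
apply: is_derive_eq.
rewrite /dsoftplus /GRing.scale/= mulr1 -mulrBr invfM.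
by rewrite mulrACA mulVf ?mul1r 1?mulrC// pnatr_eq0.
Qed.

Lemma continuous_dsoftplus d : continuous (dsoftplus d).
Proof.
move=> t.
have cB : {for t, continuous (fun t : R => t - d)}.
  by apply: continuousB; [exact: cvg_id|exact: cst_continuous].
have c0 (f : R -> R) : {for t, continuous f} ->
    {for t, continuous (fun t => Num.max 0 (f t))}.
  by move=> cf; apply: continuous_max => //; exact: cst_continuous.
have cD := continuousB (c0 _ (cvg_id : {for t, continuous (id : R -> R)})) (c0 _ cB).
exact: (continuousM cD (@cst_continuous _ _ d^-1 t)).
Qed.

Lemma dsoftplus_ge0 d t : 0 < d -> 0 <= dsoftplus d t.
Proof.
move=> d0; rewrite divr_ge0 ?(ltW d0)// subr_ge0 /Num.max.
by case: ifPn; case: ifPn; lra.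
Qed.

Lemma dsoftplus_le1 d t : 0 < d -> dsoftplus d t <= 1.
Proof.
move=> d0; rewrite ler_pdivrMr// /Num.max.
by case: ifPn; case: ifPn; rewrite -?leNgt; lra.
Qed.

Lemma softplus_eq0 d t : t <= 0 -> 0 < d -> softplus d t = 0.
Proof.
move=> t0 d0; rewrite /softplus /pos_sqr !max_l ?subrr ?mul0r//; lra.
Qed.

Lemma dsoftplus_eq0 d t : t <= 0 -> 0 < d -> dsoftplus d t = 0.
Proof.
move=> t0 d0; rewrite /dsoftplus !max_l ?subrr ?mul0r//; lra.
Qed.

Lemma softplus_approx d t : 0 < d -> `|softplus d t - Num.max 0 t| <= d.
Proof.
move=> d0; have dd : 0 < 2 * d by lra.
have [t0|t0] := leP t 0; first by rewrite softplus_eq0// subrr normr0 ltW.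
have -> : softplus d t - t = (pos_sqr t - pos_sqr (t - d) - t * (2 * d)) / (2 * d).
  by rewrite mulrBl mulfK// gt_eqF.
rewrite normrM [`|_^-1|]gtr0_norm ?invr_gt0// ler_pdivrMr// /pos_sqr (max_r (ltW t0)).
rewrite ler_norml; have [td|td] := leP (t - d) 0; apply/andP; split; nra.
Qed.

(** Shifting both one-sided ramps by [k] cuts out the dead zone [-k, k]. The dead zone makes
    truncations test functions, and the slope, which stays in [0, 1], drives the energy
    estimates. *)
Definition trunc k t := softplus k (t - k) - softplus k (- t - k).

Definition dtrunc k t := dsoftplus k (t - k) + dsoftplus k (- t - k).

Lemma is_derive_trunc k t : k != 0 -> is_derive t 1 (trunc k) (dtrunc k t).
Proof.
move=> k0; have d1 : is_derive t (1 : R) (fun t => t - k) 1.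
  by apply: is_derive_eq; rewrite subr0.
have d2 : is_derive t (1 : R) (fun t => - t - k) (-1).
  by apply: is_derive_eq; rewrite subr0.
have e1 := @is_derive1_comp _ (softplus k) (fun t => t - k) t _ _ (is_derive_softplus _ k0) d1.
have e2 := @is_derive1_comp _ (softplus k) (fun t => - t - k) t _ _ (is_derive_softplus _ k0) d2.
have -> : trunc k = (softplus k \o (fun t => t - k)) - (softplus k \o (fun t => - t - k)).
  by [].
have de := is_deriveB e1 e2; by apply: is_derive_eq; rewrite /dtrunc mulr1 mulrN1 opprK.
Qed.

Lemma continuous_dtrunc k : continuous (dtrunc k).
Proof.
move=> t.
have c1 : {for t, continuous (fun t : R => t - k)}.
  by apply: continuousB; [exact: cvg_id|exact: cst_continuous].
have c2 : {for t, continuous (fun t : R => - t - k)}.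
  by apply: continuousB; [exact: opp_continuous|exact: cst_continuous].
exact: (continuousD (continuous_comp c1 (@continuous_dsoftplus k _))
  (continuous_comp c2 (@continuous_dsoftplus k _))).
Qed.

Lemma trunc_eq0 k t : 0 < k -> `|t| <= k -> trunc k t = 0.
Proof.
by move=> k0; rewrite ler_norml => /andP[? ?]; rewrite /trunc !softplus_eq0 ?subr0//; lra.
Qed.

Lemma dtrunc_ge0 k t : 0 < k -> 0 <= dtrunc k t.
Proof. by move=> k0; rewrite addr_ge0// dsoftplus_ge0. Qed.

(** At most one of the two ramps is active, according to the sign of [t], so their slopes never add
    up beyond 1. *)
Lemma dtrunc_le1 k t : 0 < k -> dtrunc k t <= 1.
Proof.
move=> k0; rewrite /dtrunc; have [t0|t0] := leP t 0.
  by rewrite dsoftplus_eq0 ?add0r ?dsoftplus_le1//; lra.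
by rewrite [X in _ + X]dsoftplus_eq0 ?addr0 ?dsoftplus_le1//; lra.
Qed.

(** The shift costs [k], and [softplus k] costs another [k]. *)
Lemma trunc_approx k t : 0 < k -> `|trunc k t - t| <= 2 * k.
Proof.
move=> k0; have [t0|t0] := leP t 0.
  rewrite /trunc softplus_eq0//; last lra.
  have := softplus_approx (- t - k) k0; rewrite !ler_norml.
  by have [?|?] := leP (- t - k) 0 => /andP[? ?]; apply/andP; split; lra.
rewrite /trunc [X in _ - X - _]softplus_eq0//; last lra.
have := softplus_approx (t - k) k0; rewrite !ler_norml.
by have [?|?] := leP (t - k) 0 => /andP[? ?]; apply/andP; split; lra.
Qed.

End truncation.

(** * Test functions and their stability *)

Section test_functions.
Context {R : realType} {n : nat}.
Implicit Types (f g psi : 'rV[R]_n -> R) (A V : set 'rV[R]_n).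

Lemma compact_rV_closed (K : set 'rV[R]_n) : compact K -> closed K.
Proof. by apply: compact_closed; exact: norm_hausdorff. Qed.

Lemma C1_on_sum A m (F : 'I_m -> 'rV[R]_n -> R) : open A ->
  (forall i, C1_on A (F i)) -> C1_on A (fun x => \sum_(i < m) F i x).
Proof.
move=> oA CF; elim: m F CF => [|m IH] F CF.
  rewrite (_ : (fun _ => _) = cst 0); first exact: C1_on_cst.
  by apply/funext => x; rewrite big_ord0.
rewrite (_ : (fun _ => _) =
    (fun x => \sum_(i < m) F (widen_ord (leqnSn m) i) x) \+ F ord_max).
  by apply: C1_onD => //; exact: IH.
by apply/funext => x; rewrite big_ord_recr.
Qed.

Lemma test_fun0 A : test_fun A (cst 0).
Proof.
split; first exact: C1_on_cst.
by exists set0; split; [exact: compact0|exact: sub0set|].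
Qed.

Lemma test_funD A f g : test_fun A f -> test_fun A g -> test_fun A (f \+ g).
Proof.
move=> [cf [K [cK KA fK]]] [cg [L [cL LA gL]]]; split.
  by apply: C1_onD => //; exact: openT.
exists (K `|` L); split; first exact: compactU.
  by move=> x [/KA|/LA].
by move=> x /not_orP[/fK fx /gL gx]; rewrite /= fx gx addr0.
Qed.

Lemma test_fun_sum A m (F : nat -> 'rV[R]_n -> R) :
  (forall i, test_fun A (F i)) -> test_fun A (fun x => \sum_(i < m) F i x).
Proof.
move=> tF; elim: m => [|m IH].
  rewrite (_ : (fun _ => _) = cst 0); first exact: test_fun0.
  by apply/funext => x; rewrite big_ord0.
rewrite (_ : (fun _ => _) = (fun x => \sum_(i < m) F i x) \+ F m).
  exact: test_funD.
by apply/funext => x; rewrite big_ord_recr.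
Qed.

Lemma test_funMl A f g : C1_on setT f -> test_fun A g -> test_fun A (f \* g).
Proof.
move=> cf [cg [K [cK KA gK]]]; split; first by apply: C1_onM => //; exact: openT.
by exists K; split => // x /gK gx; rewrite /= gx mulr0.
Qed.

Lemma test_fun_comp A (h h' : R -> R) f :
  (forall t : R, is_derive t 1 h (h' t)) -> continuous h' -> h 0 = 0 ->
  test_fun A f -> test_fun A (h \o f).
Proof.
move=> hh ch' h0 [cf [K [cK KA fK]]]; split.
  by apply: C1_on_comp hh ch' cf; exact: openT.
by exists K; split => // x /fK fx; rewrite /= fx.
Qed.

Lemma test_fun_sub A V f : A `<=` V -> test_fun A f -> test_fun V f.
Proof.
by move=> AV [cf [K [cK KA fK]]]; split => //; exists K; split => // x /KA/AV.
Qed.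

Definition small_at_bdry A f (k : R) :=
  exists K, [/\ compact K, K `<=` A & forall x, A x -> ~ K x -> `|f x| <= k].

(** Smallness near the boundary is enough in place of vanishing there: [trunc k] kills every value
    of size at most [k], so what survives is supported in [K]. *)
Lemma test_fun_trunc A f k : open A -> 0 < k -> C1_on A f ->
  small_at_bdry A f k -> test_fun A ((trunc k \o f) \_ A).
Proof.
move=> oA k0 cf [K [cK KA fK]]; split.
  apply: (C1_on_patch oA (compact_rV_closed cK) KA).
    by move=> x Ax nKx /=; rewrite trunc_eq0// fK.
  apply: C1_on_comp (@continuous_dtrunc _ k) cf => //.
  by move=> t; apply: is_derive_trunc; rewrite gt_eqF.
exists K; split => // x nKx; rewrite patchE; case: ifPn => //.
by rewrite inE => Ax /=; rewrite trunc_eq0// fK.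
Qed.

Lemma partial_patch A f i x : open A -> A x -> partial i (f \_ A) x = partial i f x.
Proof.
move=> oA Ax; apply: near_eq_partial; near=> y.
rewrite patchE ifT// inE; near: y; exact: open_nbhs_nbhs.
Unshelve. all: by end_near. Qed.

Lemma partial_trunc A f k i x : open A -> 0 < k -> C1_on A f -> A x ->
  partial i ((trunc k \o f) \_ A) x = dtrunc k (f x) * partial i f x.
Proof.
move=> oA k0 cf Ax; rewrite partial_patch//.
apply: partial_comp; last by case: (cf x Ax).
by apply: is_derive_trunc; rewrite gt_eqF.
Qed.

End test_functions.

(** * A countable base of C^1 bumps, and measurability of open sets *)

Section bumps.
Context {R : realType} {n : nat}.
Implicit Types (V : set 'rV[R]_n).

Definition sqr_dist (a x : 'rV[R]_n) : R := \sum_(i < n) (x ord0 i - a ord0 i) ^+ 2.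

(** Built on the squared Euclidean distance, a polynomial, since the sup norm is not differentiable.
    The parameter [r] is a squared radius. *)
Definition bump (a : 'rV[R]_n) (r : R) (x : 'rV[R]_n) : R :=
  pos_sqr (r - sqr_dist a x).

Lemma sqr_dist_coord (a x : 'rV[R]_n) i : (x ord0 i - a ord0 i) ^+ 2 <= sqr_dist a x.
Proof.
by rewrite /sqr_dist (bigD1 i)//= lerDl sumr_ge0// => j _; exact: sqr_ge0.
Qed.

Lemma C1_sqr_dist a : C1_on setT (sqr_dist a).
Proof.
have oT := @openT 'rV[R]_n; apply: C1_on_sum => // i.
by apply: C1_onM => //; apply: C1_onB => //;
  [exact: C1_on_coord|exact: C1_on_cst|exact: C1_on_coord|exact: C1_on_cst].
Qed.

Lemma C1_bump a r : C1_on setT (bump a r).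
Proof.
have oT := @openT 'rV[R]_n.
apply: (@C1_on_comp _ _ _ pos_sqr (fun t => 2 * Num.max 0 t)) => //.
- by move=> t; exact: is_derive_pos_sqr.
- move=> t; apply: (@continuousM _ _ (cst 2)); first exact: cst_continuous.
  by apply: continuous_max; [exact: cst_continuous|exact: cvg_id].
- by apply: C1_onB => //; [exact: C1_on_cst|exact: C1_sqr_dist].
Qed.

Lemma bump_ge0 a r x : 0 <= bump a r x.
Proof. exact: sqr_ge0. Qed.

Lemma bump_gt0 a r x : (0 < bump a r x) = (sqr_dist a x < r).
Proof.
rewrite /bump /pos_sqr lt_def sqr_ge0 andbT sqrf_eq0 -(subr_gt0 _ r).
by have [u0|u0] := leP (r - sqr_dist a x) 0; rewrite ?eqxx// gt_eqF.
Qed.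

Lemma compact_sqr_dist a r : compact [set x | sqr_dist a x <= r].
Proof.
apply: bounded_closed_compact.
  exists (`|a| + `|r| + 1); split; first exact: num_real.
  move=> M hM x /= xr; rewrite /Num.Def.normr/= mx_normrE (bigmax_le)//=.
    by rewrite (le_trans _ (ltW hM))//.
  move=> [j i] _ /=; rewrite (ord1 j); apply: le_trans (ltW hM).
  have xi : `|x ord0 i - a ord0 i| <= `|r| + 1.
    rewrite -ler_sqr ?nnegrE ?addr_ge0//.
    rewrite -normrX ger0_norm ?sqr_ge0//.
    have := sqr_dist_coord a x i; have := ler_norm r; have := normr_ge0 r; nra.
  have ai : `|a ord0 i| <= `|a|.
    by rewrite [leRHS]/Num.Def.normr/= mx_normrE (le_bigmax _ (fun ij => `|a ij.1 ij.2|) (ord0, i)).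
  by rewrite -[x ord0 i](subrK (a ord0 i)) (le_trans (ler_normD _ _))//; lra.
rewrite (_ : [set _ | _] = sqr_dist a @^-1` [set t | t <= r])//.
apply: closed_comp; last exact: closed_le.
by move=> x _; apply: C1_on_continuous (C1_sqr_dist a) _.
Qed.

Lemma test_bump V a r : (forall x, sqr_dist a x <= r -> V x) -> test_fun V (bump a r).
Proof.
move=> aV; split; first exact: C1_bump.
exists [set x | sqr_dist a x <= r]; split => //; first exact: compact_sqr_dist.
move=> x /= /negP; rewrite -ltNge => rx.
by rewrite /bump /pos_sqr max_l ?expr0n// subr_le0 ltW.
Qed.

Lemma measurable_bump a r : measurable_fun setT (bump a r).
Proof.
apply: measurable_funX; apply: measurable_maxr => //.
apply: measurable_funB => //; apply: measurable_sum => i.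
apply: measurable_funX; apply: measurable_funB => //.
exact: measurable_rV_coord.
Qed.

Lemma rat_bump V x : open V -> V x -> exists (q : 'rV[rat]_n) (m : nat),
  0 < bump (map_mx ratr q) (m.+1%:R ^- 2) x /\
  (forall y, sqr_dist (map_mx ratr q) y <= m.+1%:R ^- 2 -> V y).
Proof.
move=> oV Vx; have [e /= e0 eV] : nbhs_ball x V by apply/nbhs_ballP; exact: open_nbhs_nbhs.
have [m me] : exists m : nat, m.+1%:R^-1 * 2 < e.
  near \oo => m; exists m.
  rewrite -ltr_pdivlMr//; near: m; apply: near_infty_natSinv_lt (PosNum _).
  by rewrite divr_gt0.
set s : R := m.+1%:R^-1; have s0 : 0 < s by rewrite invr_gt0 ltr0n.
(* If each coordinate of the centre is within d = s/(n+1) of that of [x], the squared distance is at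
   most n d^2 < (n+1)^2 d^2 = s^2, also for n = 0. Points of the ball are then within d + s <= 2 s <
   e of [x] in sup norm. *)
set d : R := s / n.+1%:R; have d0 : 0 < d by rewrite divr_gt0// ltr0n.
have qx (i : 'I_n) : exists q : rat, ratr q \in `]x ord0 i - d, x ord0 i + d[.
  by apply: rat_in_itvoo; lra.
pose q : 'rV[rat]_n := \row_i sval (cid (qx i)).
have qE i : `|x ord0 i - ratr (q ord0 i)| < d.
  rewrite mxE; case: cid => /= p; rewrite in_itv/= => /andP[? ?].
  by rewrite ltr_norml; apply/andP; split; lra.
exists q, m; set a := map_mx _ _; set r : R := _ ^- 2.
have rs : r = s ^+ 2 by rewrite /r /s exprVn.
split.
  rewrite bump_gt0 (@le_lt_trans _ _ (\sum_(i < n) d ^+ 2))//.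
    apply: ler_sum => i _; rewrite mxE -[leLHS]ger0_norm ?sqr_ge0// normrX.
    by rewrite ler_sqr ?nnegrE// ltW.
  have sd : s = d * n.+1%:R by rewrite divfK// pnatr_eq0.
  rewrite sumr_const card_ord rs [X in _ < X ^+ 2]sd [X in _ < X]exprMn
    -natrX -[X in X < _]mulr_natr ltr_pM2l ?exprn_gt0//.
  by rewrite ltr_nat expnS expn1 mulSn leq_addr.
move=> y ay; apply: eV; rewrite -ball_normE /= /Num.Def.normr/= mx_normrE.
apply: (bigmax_lt _ e0) => -[j i] _ /=; rewrite !mxE (ord1 j).
have yi : `|y ord0 i - ratr (q ord0 i)| <= s.
  rewrite -ler_sqr ?nnegrE ?(ltW s0)// -normrX ger0_norm ?sqr_ge0// -rs.
  by apply: le_trans ay; have := sqr_dist_coord a y i; rewrite mxE.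
have ds : d <= s by rewrite ler_pdivrMr ?ltr0n// ler_peMr ?(ltW s0)// ler1n.
have me2 : s * 2 < e := me.
have := qE i; move: yi; rewrite ler_norml !ltr_norml => /andP[? ?] /andP[? ?].
by apply/andP; split; lra.
Unshelve. all: by end_near. Qed.

(** Rational centres and radii 1/(m+1) suffice, so the family is countable; indices that code no
    ball inside [V] give the zero function. Countability yields the measurability of open sets and,
    later, one null set valid for all bumps at once. *)
Lemma open_bumps V : open V -> exists b : nat -> 'rV[R]_n -> R,
  [/\ forall j, test_fun V (b j), forall j, measurable_fun setT (b j),
      forall j x, 0 <= b j x & forall x, V x -> exists j, 0 < b j x].
Proof.
move=> oV; pose good (p : 'rV[rat]_n * nat) :=
  forall y : 'rV[R]_n, sqr_dist (map_mx ratr p.1) y <= p.2.+1%:R ^- 2 -> V y.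
pose b j := if unpickle j is Some p then
  if `[< good p >] then bump (map_mx ratr p.1) (p.2.+1%:R ^- 2) else cst 0 : 'rV[R]_n -> R
  else cst 0.
exists b; split.
- move=> j; rewrite /b; case: unpickle => [p|]; last exact: test_fun0.
  by case: asboolP => [gp|_]; [exact: test_bump|exact: test_fun0].
- move=> j; rewrite /b; case: unpickle => [p|//].
  by case: asboolP => [gp|_//]; exact: measurable_bump.
- move=> j x; rewrite /b; case: unpickle => [p|//].
  by case: asboolP => [gp|_//]; exact: bump_ge0.
- move=> x Vx; have [q [m [bx gqm]]] := rat_bump oV Vx.
  by exists (pickle (q, m)); rewrite /b pickleK; case: asboolP.
Qed.

(** The sigma-algebra is the one generated by the coordinates, so the open set is exhibited as the
    countable union of the sets where a bump is positive. *)
Lemma measurable_open_rV V : open V -> measurable V.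
Proof.
move=> oV; have [b [tb mb _ bV]] := open_bumps oV.
rewrite (_ : V = \bigcup_j (b j @^-1` `]0, +oo[)).
  apply: bigcupT_measurable => j; rewrite -[X in measurable X]setTI.
  by apply: mb => //; exact: measurable_itv.
apply/seteqP; split => x.
  by move=> /bV[j bj]; exists j => //=; rewrite in_itv/= bj.
move=> [j _ /=]; rewrite in_itv/= andbT => bj; apply: contrapT => nVx.
have [_ [K [_ KV bK]]] := tb j; move: bj; rewrite bK ?ltxx// => /KV.
exact.
Qed.

(** At a point of [V] the partial sums [S j] are eventually bounded below by a positive number;
    [h j], which is 0 at 0 and equals 1 as soon as j t >= 1, saturates them. *)
Lemma open_indicator_approx V : open V -> exists psi : nat -> 'rV[R]_n -> R,
  [/\ forall j, test_fun V (psi j), forall j x, 0 <= psi j x <= 1 &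
      forall x, V x -> \forall j \near \oo, psi j x = 1].
Proof.
move=> oV; have [b [tb _ b0 bV]] := open_bumps oV.
pose S j x := \sum_(i < j) b i x.
have S0 j x : 0 <= S j x by exact: sumr_ge0.
pose h (j : nat) (t : R) := 1 - pos_sqr (1 - j%:R * t).
exists (fun j => h j \o S j); split.
- move=> j.
  apply: (@test_fun_comp _ _ _ _ (fun t => j%:R * (2 * Num.max 0 (1 - j%:R * t)))).
  + move=> t; have d1 : is_derive t (1 : R) (fun t => 1 - j%:R * t) (- j%:R).
      by apply: is_derive_eq; rewrite add0r mul1r /GRing.scale/= mulr1.
    have d2 := @is_derive1_comp _ pos_sqr _ t _ _ (is_derive_pos_sqr _) d1.
    rewrite (_ : h j = cst 1 - (pos_sqr \o (fun t => 1 - j%:R * t)))//.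
    by apply: is_derive_eq; rewrite sub0r mulrN opprK mulrC.
  + move=> t; have cst_cont c : {for t, continuous (cst c : R -> R)}.
      exact: cst_continuous.
    have cj : {for t, continuous (fun t : R => 1 - j%:R * t)}.
      exact: (continuousB (cst_cont 1) (continuousM (cst_cont j%:R)
        (cvg_id : {for t, continuous (id : R -> R)}))).
    exact: (continuousM (cst_cont j%:R) (continuousM (cst_cont 2)
      (continuous_max (cst_cont 0) cj))).
  + by rewrite /h mulr0 subr0 /pos_sqr max_r// expr1n subrr.
  + exact: test_fun_sum.
- move=> j x; rewrite /h /= /pos_sqr.
  have jS : 0 <= j%:R * S j x by rewrite mulr_ge0.
  by have [?|?] := leP (1 - j%:R * S j x) 0; apply/andP; split; nra.
- move=> x /bV[i bi]; near=> j.
  have ij : (i < j)%N by near: j; exact: nbhs_infty_gt.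
  have Sj : b i x <= S j x.
    by rewrite /S (bigD1 (Ordinal ij))//= lerDl sumr_ge0.
  have jb : (b i x)^-1 <= j%:R by near: j; exact: nbhs_infty_ger.
  rewrite /h /= /pos_sqr max_l ?expr0n ?subr0// subr_le0.
  rewrite -[leLHS](mulVf (lt0r_neq0 bi)).
  by apply: (ler_pM _ _ jb Sj); rewrite ?invr_ge0 b0.
Unshelve. all: by end_near. Qed.

End bumps.

(** * Cubes and Fubini: derivatives of compactly supported functions have integral 0 *)

Section cubes.
Context {R : realType}.

Definition cube n (L : R) : set 'rV[R]_n := [set x | forall j, `|x ord0 j| <= L].

Lemma measurable_cube n L : measurable (@cube n L).
Proof.
rewrite (_ : @cube n L = \bigcap_(j : 'I_n) (@rV_coord R n j @^-1` `[- L, L])).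
  apply: fin_bigcap_measurable; first exact: finite_finset.
  move=> j _; rewrite -[X in measurable X]setTI.
  by apply: measurable_rV_coord => //; exact: measurable_itv.
apply/seteqP; split => x /= xL j; first by move=> _; rewrite /= in_itv/= -ler_norml xL.
by have := xL j I; rewrite /= in_itv/= -ler_norml.
Qed.

Lemma rV_cons_cube n L : rV_cons @^-1` @cube n.+1 L = `[- L, L] `*` @cube n L.
Proof.
apply/seteqP; split => [[t y] /= h|[t y] /= [tL yL] j].
  split; first by have := h ord0; rewrite rV_cons0/= ler_norml in_itv.
  by move=> j; have := h (lift ord0 j); rewrite rV_consS.
have [j' ->|->] := unliftP ord0 j; first by rewrite rV_consS.
by rewrite rV_cons0 ler_norml; move: tL; rewrite in_itv.
Qed.

Lemma lebesgue_rV_cube n L : (lebesgue_rV n (@cube n L) < +oo)%E.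
Proof.
elim: n => [|n IH]; first by rewrite /= /lebesgue_rV0 diracE ltry.
rewrite /= /lebesgue_rVS /pushforward rV_cons_cube product_measure1E//=; last first.
  exact: measurable_cube.
rewrite lte_mul_pinfty//; rewrite lebesgue_measure_itv/=; by case: ifP.
Qed.

Lemma integrable_cube n (L M : R) (f : 'rV[R]_n -> R) :
  measurable_fun setT f -> (forall x, `|f x| <= M) ->
  (forall x, ~ cube L x -> f x = 0) ->
  (lebesgue_rV n).-integrable setT (EFin \o f).
Proof.
move=> mf fM f0; have mC := @measurable_cube n L.
rewrite (_ : EFin \o f = (EFin \o f) \_ (@cube n L)); last first.
  by apply/funext => x; rewrite patchE; case: ifPn => //; rewrite notin_setE => /f0 /= ->.
apply/(integrable_mkcond _ mC); apply: measurable_bounded_integrable => //.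
- exact: lebesgue_rV_cube.
- exact: measurable_funTS.
- by exists M; split; [exact: num_real|move=> N MN x _; exact: le_trans (fM x) (ltW MN)].
Qed.

(* [lebesgue_measure] lives on [measurableTypeR R], whose display is not the one
   found for [R] in [measurable_rV_cons]. *)
Lemma measurable_rV_consR n :
  @measurable_fun _ _ (measurableTypeR R * 'rV[R]_n)%type 'rV[R]_n.+1 setT rV_cons.
Proof. exact: measurable_rV_cons. Qed.

Lemma integral_deriv_line (L : R) (f f' : R -> R) :
  (forall t, L < `|t| -> f t = 0 /\ f' t = 0) ->
  (forall t : R, is_derive t 1 f (f' t)) -> continuous f' ->
  (\int[lebesgue_measure]_t (f' t)%:E = 0)%E.
Proof.
(* Beyond |L|, so that [f] vanishes at both endpoints of [-K, K]. *)
move=> f0 df cf'; pose K := `|L| + 1.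
have LK : L < K by rewrite (le_lt_trans (ler_norm L))// ltrDl.
have K0 : 0 < K by rewrite ltr_wpDl.
have nKK : - K < K by lra.
have -> : (fun t => (f' t)%:E) = (EFin \o f') \_ `[- K, K].
  apply/funext => t; rewrite patchE; case: ifPn => //.
  rewrite notin_setE/= in_itv/= -ler_norml => /negP; rewrite -ltNge => Kt.
  by have [_ ->] := f0 t (lt_trans LK Kt).
have [fK _] : f K = 0 /\ f' K = 0 by apply: f0; rewrite gtr0_norm.
have [fNK _] : f (- K) = 0 /\ f' (- K) = 0 by apply: f0; rewrite normrN gtr0_norm.
rewrite -integral_mkcond/= (@continuous_FTC2 _ f' f)//.
- by rewrite fK fNK subee.
- exact: continuous_subspaceT.
- have cf x : {for x, continuous f}.
    by apply: differentiable_continuous; apply/derivable1_diffP; case: (df x).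
  split; first by move=> x _; case: (df x).
    exact: cvg_at_right_filter (cf _).
  exact: cvg_at_left_filter (cf _).
- by move=> x _; rewrite derive1E; case: (df x).
Qed.

(** Induction on the dimension by Fubini. The derivative is carried as a separate function [F'],
    tied to [F] only along lines in direction [i], because this form is inherited by the slices with
    first coordinate fixed. *)
Lemma integral_partial_eq0 n (i : 'I_n) (F F' : 'rV[R]_n -> R) (M L : R) :
  measurable_fun setT F' -> (forall x, `|F' x| <= M) ->
  (forall x, ~ cube L x -> F x = 0 /\ F' x = 0) ->
  (forall x t, is_derive t (1 : R)
     (fun s : R => F (x + s *: delta_mx ord0 i)) (F' (x + t *: delta_mx ord0 i))) ->
  (forall x, continuous (fun s : R => F' (x + s *: delta_mx ord0 i))) ->
  (\int[lebesgue_rV n]_x (F' x)%:E = 0)%E.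
Proof.
elim: n i F F' => [|n IH]; first by case.
move=> i F F' mF' bF' F0 dF cF'.
have iF' : (lebesgue_rV n.+1).-integrable setT (EFin \o F').
  by apply: integrable_cube mF' bF' _ => x /F0[].
have mG : @measurable_fun _ _ (measurableTypeR R * 'rV[R]_n)%type _ setT (F' \o rV_cons).
  exact: measurableT_comp mF' (@measurable_rV_consR n).
have G0 t y : ~ (`[- L, L] `*` @cube n L) (t, y) ->
    F (rV_cons (t, y)) = 0 /\ F' (rV_cons (t, y)) = 0.
  by rewrite -rV_cons_cube; exact: F0.
have iG : (lebesgue_measure \x lebesgue_rV n)%E.-integrable setT
    (EFin \o (F' \o rV_cons)).
  rewrite (_ : EFin \o _ = (EFin \o (F' \o rV_cons)) \_ (rV_cons @^-1` @cube n.+1 L)); last first.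
    apply/funext => x; rewrite patchE; case: ifPn => //.
    by rewrite notin_setE => /= /F0[_ ->].
  have mC : measurable (rV_cons @^-1` @cube n.+1 L : set (measurableTypeR R * 'rV[R]_n)%type).
    rewrite -[X in measurable X]setTI.
    apply: (@measurable_rV_consR n measurableT).
    exact: measurable_cube.
  apply/(integrable_mkcond _ mC); apply: measurable_bounded_integrable => //.
  - exact: (lebesgue_rV_cube n.+1 L).
  - exact: measurable_funTS.
  - by exists M; split; [exact: num_real|move=> N MN x _; exact: le_trans (bF' _) (ltW MN)].
have mF : measurable_fun setT (EFin \o F') by exact: measurableT_comp.
have push := integral_pushforward (@measurable_rV_consR n) mF iG measurableT.
have -> : (\int[lebesgue_rV n.+1]_x (F' x)%:E =
    \int[lebesgue_measure \x lebesgue_rV n]_z (F' (rV_cons z))%:E)%E.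
  by rewrite -[RHS]push.
(* If [i] is not the first axis, the inner integral over the tail is 0 by induction; otherwise the
   order is exchanged and the inner integral over the first coordinate is 0 by the one-dimensional
   case. *)
have [j ij|i0] := unliftP ord0 i.
  rewrite -(integral12_prod_meas1 iG)/= integral0_eq// => t _.
  rewrite /fubini_F/=.
  have consD y s : rV_cons (t, y) + s *: delta_mx ord0 i =
      rV_cons (t, y + s *: delta_mx ord0 j).
    apply/rowP => l; rewrite mxE; have [l' ->|->] := unliftP ord0 l.
      by rewrite !rV_consS /= !mxE ij (inj_eq lift_inj).
    by rewrite !rV_cons0 /= !mxE ij (negbTE (neq_lift _ _)) andbF mulr0 addr0.
  apply: (IH j (fun y => F (rV_cons (t, y))) (fun y => F' (rV_cons (t, y)))) => //.
  - apply: measurableT_comp mG _; exact: measurable_pair1.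
  - move=> y ny; apply: G0 => -[_]; exact.
  - move=> y s; have := dF (rV_cons (t, y)) s; rewrite consD.
    by congr (is_derive _ _ _ _); apply/funext => r; rewrite consD.
  - move=> y; have := cF' (rV_cons (t, y)).
    rewrite (_ : (fun r : R => _) = (fun r => F' (rV_cons (t, y + r *: delta_mx ord0 j)))) //.
    by apply/funext => r; rewrite consD.
rewrite -(integral21_prod_meas1 iG)/= integral0_eq// => y _.
rewrite /fubini_G/=.
have consD s : rV_cons (0, y) + s *: delta_mx ord0 i = rV_cons (s, y).
  apply/rowP => l; rewrite mxE; have [l' ->|->] := unliftP ord0 l.
    by rewrite !rV_consS /= !mxE i0 [lift _ _ == _]eq_sym (negbTE (neq_lift _ _)) andbF mulr0 addr0.
  by rewrite !rV_cons0 /= !mxE i0 eqxx mulr1 add0r.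
apply: (@integral_deriv_line L (fun t => F (rV_cons (t, y)))).
- move=> t Lt; apply: G0 => -[/= + _]; rewrite in_itv/= -ler_norml => /(lt_le_trans Lt).
  by rewrite ltxx.
- move=> s; have := dF (rV_cons (0, y)) s; rewrite consD.
  by congr (is_derive _ _ _ _); apply/funext => t; rewrite consD.
- have := cF' (rV_cons (0, y)).
  rewrite (_ : (fun r : R => _) = (fun r => F' (rV_cons (r, y)))) //.
  by apply/funext => r; rewrite consD.
Qed.

End cubes.

(** * Continuous functions and their integrals on subsets of R^n *)

Section integration.
Context {R : realType} {n : nat}.
Implicit Types (f g psi : 'rV[R]_n -> R) (A K : set 'rV[R]_n).
Local Notation mu := (lebesgue_rV n).

Definition continuous_on A g := forall x, A x -> {for x, continuous g}.

Lemma continuous_on_measurable A g : open A -> continuous_on A g -> measurable_fun A g.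
Proof.
move=> oA cg.
apply: (@measurability _ _ _ _ A g (RGenOInfty.G (R := R))).
  exact: RGenOInfty.measurableE.
move=> _ [_ [y ->] <-]; apply: measurable_open_rV; rewrite openE => x [Ax gx].
have := cg x Ax; move/(_ `]y, +oo[%classic) => /= cgx.
apply: filterI; first exact: open_nbhs_nbhs.
apply: cgx; apply: open_nbhs_nbhs; split => //.
Qed.

Lemma C1_on_continuous_on A f : C1_on A f -> continuous_on A f.
Proof. by move=> cf x Ax; exact: C1_on_continuous cf Ax. Qed.

Lemma C1_on_partial_continuous_on A f i : C1_on A f -> continuous_on A (partial i f).
Proof. by move=> cf x /cf[]. Qed.

Lemma bounded_cube A : bounded_set A -> exists L : R, A `<=` @cube R n L.
Proof.
move=> [M [_ MK]]; exists (M + 1) => x Kx j.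
have : `|x| <= M + 1 by apply: MK => //; rewrite ltrDl.
apply: le_trans.
by rewrite [leRHS]/Num.Def.normr/= mx_normrE (le_bigmax _ (fun ij => `|x ij.1 ij.2|) (ord0, j)).
Qed.

Lemma compact_cube K : compact K -> exists L : R, K `<=` @cube R n L.
Proof. by move=> /compact_bounded; exact: bounded_cube. Qed.

Lemma bounded_lebesgue_rV A : open A -> bounded_set A -> (mu A < +oo)%E.
Proof.
move=> oA /bounded_cube[L AL].
apply: le_lt_trans (lebesgue_rV_cube n L); apply: le_measure => //.
  by rewrite inE; exact: measurable_open_rV.
by rewrite inE; exact: measurable_cube.
Qed.

Lemma continuous_compact_bounded K g : compact K -> continuous_on K g ->
  exists2 M : R, 0 <= M & forall x, K x -> `|g x| <= M.
Proof.
move=> cK cg.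
have /compact_bounded[M [_ MK]] : compact (g @` K).
  apply: continuous_compact => //; apply: continuous_in_subspaceT => x /[!inE].
  exact: cg.
exists (Num.max 0 (M + 1)) => [|x Kx]; first by rewrite le_max lexx.
by rewrite le_max; apply/orP; right; apply: MK; [rewrite ltrDl|exists x].
Qed.

Lemma compact_support_bounded A K g : compact K -> K `<=` A -> continuous_on A g ->
  (forall x, A x -> ~ K x -> g x = 0) ->
  exists2 M : R, 0 <= M & forall x, A x -> `|g x| <= M.
Proof.
move=> cK KA cg g0.
have [M M0 MK] := continuous_compact_bounded cK (fun x Kx => cg x (KA x Kx)).
exists M => // x Ax; have [Kx|nKx] := pselect (K x); first exact: MK.
by rewrite g0// normr0.
Qed.

Lemma bounded_integrable A f : measurable A -> (mu A < +oo)%E -> measurable_fun A f ->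
  (exists2 M : R, 0 <= M & forall x, A x -> `|f x| <= M) ->
  mu.-integrable A (EFin \o f).
Proof.
move=> mA Afin mf [M _ fM]; apply: measurable_bounded_integrable => //.
by exists M; split; [exact: num_real|move=> N MN x Ax; exact: le_trans (fM x Ax) (ltW MN)].
Qed.

Lemma test_fun_partial0 K psi i x : closed K -> (forall y, ~ K y -> psi y = 0) ->
  ~ K x -> partial i psi x = 0.
Proof.
move=> cK p0 nKx; rewrite -(partial_cst i 0 x); apply: near_eq_partial.
have H : nbhs x (~` K) by apply: open_nbhs_nbhs; split => //; exact: closed_openC.
by apply: filterS H => y nKy; rewrite p0.
Qed.

Lemma is_derive_line f (x v : 'rV[R]_n) (t : R) : differentiable f (x + t *: v) ->
  is_derive t (1 : R) (fun s : R => f (x + s *: v)) ('D_v f (x + t *: v)).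
Proof.
move=> dfx; have df : derivable f (x + t *: v) v by exact: diff_derivable.
have E : (fun h : R => h^-1 *: (f (x + (h *: 1 + t) *: v) - f (x + t *: v))) =
    (fun h => h^-1 *: (f (h *: v + (x + t *: v)) - f (x + t *: v))).
  apply/funext => h; congr (_ *: (f _ - _)).
  by rewrite [h *: 1]mulr1 scalerDl addrCA addrA.
by apply: DeriveDef; rewrite /derivable /derive/= E.
Qed.

Lemma continuous_line (x v : 'rV[R]_n) : continuous (fun s : R => x + s *: v).
Proof.
move=> t; have cv : {for t, continuous (fun s : R => s *: v)} by exact: scalel_continuous.
exact: (continuousD (@cst_continuous _ _ x t) cv).
Qed.

Lemma integral_test_fun_partial A i psi : open A -> test_fun A psi ->
  \int[mu]_(x in A) partial i psi x = 0.
Proof.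
move=> oA [cpsi [K [cK KA psi0]]]; have clK := compact_rV_closed cK.
have p0 x : ~ K x -> partial i psi x = 0 by exact: test_fun_partial0.
have -> : \int[mu]_(x in A) partial i psi x = \int[mu]_x partial i psi x.
  rewrite Rintegral_mkcond; apply: eq_Rintegral => x _; rewrite patchE; case: ifPn => //.
  by rewrite notin_setE => nAx; rewrite p0// => /KA.
have cp : continuous_on setT (partial i psi) by exact: C1_on_partial_continuous_on.
have mp := continuous_on_measurable openT cp.
have [M M0 bM] : exists2 M : R, 0 <= M & forall x, [set: 'rV[R]_n] x -> `|partial i psi x| <= M.
  by apply: compact_support_bounded cK _ cp _ => // x _; exact: p0.
have [L KL] := compact_cube cK.
suff E : (\int[mu]_x (partial i psi x)%:E = 0)%E by rewrite /Rintegral E.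
apply: (@integral_partial_eq0 _ n i psi _ M L) => //.
- by move=> x; exact: bM.
- by move=> x nx; split; [apply: psi0|apply: p0] => /KL.
- move=> x t; have [dx _] := cpsi (x + t *: delta_mx ord0 i) I.
  exact: is_derive_line.
- move=> x t.
  exact: (continuous_comp (@continuous_line x _ t) (cp _ I)).
Qed.

End integration.

(** * Algebra of square integrable functions *)

Section square_integrable.
Context d (T : measurableType d) (R : realType).
Variables (mu : {measure set T -> \bar R}) (D : set T).
Hypothesis mD : measurable D.
Implicit Types f g : T -> R.

Definition L2 f := measurable_fun D f /\ mu.-integrable D (EFin \o (fun x => f x ^+ 2)).

Lemma measurable_dominated_integrable f g : measurable_fun D f ->
  mu.-integrable D (EFin \o g) -> (forall x, D x -> `|f x| <= g x) ->
  mu.-integrable D (EFin \o f).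
Proof.
move=> mf ig fg; apply: le_integrable ig => //; first exact: measurableT_comp.
by move=> x Dx /=; rewrite lee_fin (le_trans (fg x Dx))// ler_norm.
Qed.

Lemma integrableD_EFin f g : mu.-integrable D (EFin \o f) -> mu.-integrable D (EFin \o g) ->
  mu.-integrable D (EFin \o (fun x => f x + g x)).
Proof. by move=> intf intg; exact: (integrableD mD intf intg). Qed.

Lemma integrableZl_EFin k f : mu.-integrable D (EFin \o f) ->
  mu.-integrable D (EFin \o (fun x => k * f x)).
Proof. by move=> intf; exact: (integrableZl mD k intf). Qed.

Lemma integrableB_EFin f g : mu.-integrable D (EFin \o f) -> mu.-integrable D (EFin \o g) ->
  mu.-integrable D (EFin \o (fun x => f x - g x)).
Proof. by move=> intf intg; exact: (integrableB mD intf intg). Qed.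

Lemma integrable_sum_EFin m (F : 'I_m -> T -> R) :
  (forall i, mu.-integrable D (EFin \o F i)) ->
  mu.-integrable D (EFin \o (fun x => \sum_(i < m) F i x)).
Proof.
elim: m F => [|m IH] F iF.
  rewrite (_ : _ \o _ = cst 0%E); first exact: integrable0.
  by apply/funext => x; rewrite /= big_ord0.
rewrite (_ : _ \o _ = EFin \o (fun x =>
    \sum_(i < m) F (widen_ord (leqnSn m) i) x + F ord_max x)).
  by apply: integrableD_EFin => //; exact: IH.
by apply/funext => x; rewrite /= big_ord_recr.
Qed.

Lemma Rintegral_sum m (F : 'I_m -> T -> R) :
  (forall i, mu.-integrable D (EFin \o F i)) ->
  \int[mu]_(x in D) (\sum_(i < m) F i x) = \sum_(i < m) \int[mu]_(x in D) F i x.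
Proof.
elim: m F => [|m IH] F iF.
  rewrite big_ord0 (_ : (fun _ => _) = cst 0) ?Rintegral_cst ?mul0r//.
  by apply/funext => x; rewrite big_ord0.
rewrite big_ord_recr/= -IH// -RintegralD//.
  by apply: eq_Rintegral => x _; rewrite big_ord_recr.
exact: integrable_sum_EFin.
Qed.

Lemma L2M f g : L2 f -> L2 g -> mu.-integrable D (EFin \o (fun x => f x * g x)).
Proof.
move=> [mf if2] [mg ig2].
apply: (measurable_dominated_integrable _ (integrableD_EFin if2 ig2)).
  exact: measurable_funM.
by move=> x _; rewrite ler_norml; apply/andP; split; nra.
Qed.

Lemma L2Z k f : L2 f -> L2 (fun x => k * f x).
Proof.
move=> [mf if2]; split; first by apply: measurable_funM.
rewrite (_ : (fun x => (k * f x) ^+ 2) = (fun x => k ^+ 2 * f x ^+ 2)).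
  exact: integrableZl_EFin.
by apply/funext => x; rewrite exprMn.
Qed.

Lemma L2D f g : L2 f -> L2 g -> L2 (fun x => f x + g x).
Proof.
move=> Lf Lg; have [mf if2] := Lf; have [mg ig2] := Lg.
split; first exact: measurable_funD.
apply: (measurable_dominated_integrable _ (integrableZl_EFin 2 (integrableD_EFin if2 ig2))).
  by apply: measurable_funX; exact: measurable_funD.
by move=> x _; rewrite ger0_norm ?sqr_ge0//; have := sqr_ge0 (f x - g x); nra.
Qed.

Lemma L2B f g : L2 f -> L2 g -> L2 (fun x => f x - g x).
Proof.
move=> Lf Lg; rewrite (_ : (fun _ => _) = (fun x => f x + (-1) * g x)).
  by apply: L2D => //; exact: L2Z.
by apply/funext => x; rewrite mulN1r.
Qed.

Lemma L2_bounded f : (mu D < +oo)%E -> measurable_fun D f ->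
  (exists M : R, forall x, D x -> `|f x| <= M) -> L2 f.
Proof.
move=> Dfin mf [M fM]; split => //; apply: measurable_bounded_integrable => //.
  exact: measurable_funX.
exists (M ^+ 2); split; first exact: num_real.
move=> N MN x Dx; apply: le_trans (ltW MN); rewrite normrX.
by rewrite ler_sqr ?nnegrE ?fM// (le_trans _ (fM x Dx)).
Qed.

End square_integrable.

(** * Integration by parts and the Poincare inequality for test functions *)

Section energy.
Context {R : realType} {n : nat}.
Implicit Types (f g w psi : 'rV[R]_n -> R) (A K : set 'rV[R]_n).
Local Notation mu := (lebesgue_rV n).
Variable A : set 'rV[R]_n.
Hypotheses (oA : open A) (bA : bounded_set A).

Let mA : measurable A. Proof. exact: measurable_open_rV. Qed.
Let Afin : (mu A < +oo)%E. Proof. exact: bounded_lebesgue_rV. Qed.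

Definition compactly_supported f :=
  exists K, [/\ compact K, K `<=` A & forall x, A x -> ~ K x -> f x = 0].

Lemma compactly_supported_bounded f : compactly_supported f -> continuous_on A f ->
  exists M : R, forall x, A x -> `|f x| <= M.
Proof.
by move=> [K [cK KA f0]] cf; have [M _ fM] := compact_support_bounded cK KA cf f0; exists M.
Qed.

Lemma compactly_supported_L2 f : compactly_supported f -> continuous_on A f -> L2 mu A f.
Proof.
move=> sf cf; apply: L2_bounded => //; first exact: continuous_on_measurable.
exact: compactly_supported_bounded.
Qed.

Lemma compactly_supported_integrable f : compactly_supported f -> continuous_on A f ->
  mu.-integrable A (EFin \o f).
Proof.
move=> sf cf; have [M fM] := compactly_supported_bounded sf cf.
apply: bounded_integrable => //; first exact: continuous_on_measurable.
exists (Num.max 0 M) => [|x Ax]; first by rewrite le_max lexx.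
by rewrite le_max; apply/orP; right; exact: fM.
Qed.

Lemma compactly_supportedM f g : compactly_supported g -> compactly_supported (fun x => f x * g x).
Proof.
by move=> [K [cK KA g0]]; exists K; split => // x Ax Kx; rewrite g0 ?mulr0.
Qed.

Lemma continuous_onM f g : continuous_on A f -> continuous_on A g ->
  continuous_on A (fun x => f x * g x).
Proof. by move=> cf cg x Ax; exact: continuousM (cf x Ax) (cg x Ax). Qed.

Lemma test_fun_continuous psi : test_fun A psi -> continuous_on A psi.
Proof. by move=> [cpsi _] x Ax; exact: C1_on_continuous cpsi _. Qed.

Lemma test_fun_partial_continuous psi i : test_fun A psi -> continuous_on A (partial i psi).
Proof. by move=> [cpsi _] x Ax; case: (cpsi x I). Qed.

Lemma test_fun_supported psi : test_fun A psi -> compactly_supported psi.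
Proof. by move=> [_ [K [cK KA psi0]]]; exists K; split => // x _; exact: psi0. Qed.

Lemma test_fun_partial_supported psi i : test_fun A psi -> compactly_supported (partial i psi).
Proof.
move=> [_ [K [cK KA psi0]]]; exists K; split => // x _.
by apply: test_fun_partial0 => //; exact: compact_rV_closed.
Qed.

Lemma test_fun_L2 psi : test_fun A psi -> L2 mu A psi.
Proof.
move=> tpsi; apply: compactly_supported_L2; first exact: test_fun_supported.
exact: test_fun_continuous.
Qed.

Lemma test_fun_partial_L2 psi i : test_fun A psi -> L2 mu A (partial i psi).
Proof.
move=> tpsi; apply: compactly_supported_L2; first exact: test_fun_partial_supported.
exact: test_fun_partial_continuous.
Qed.

Lemma test_funM_integrable f psi : continuous_on A f -> test_fun A psi ->
  mu.-integrable A (EFin \o (fun x => f x * psi x)).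
Proof.
move=> cf tpsi; apply: compactly_supported_integrable.
  by apply: compactly_supportedM; exact: test_fun_supported.
by apply: continuous_onM => //; exact: test_fun_continuous.
Qed.

Lemma test_funM_partial_integrable f psi i : continuous_on A f -> test_fun A psi ->
  mu.-integrable A (EFin \o (fun x => f x * partial i psi x)).
Proof.
move=> cf tpsi; apply: compactly_supported_integrable.
  by apply: compactly_supportedM; exact: test_fun_partial_supported.
by apply: continuous_onM => //; exact: test_fun_partial_continuous.
Qed.

(** Since [f] is C^1 on [A] only, the product with [psi] is extended by 0 outside [A]; this is a
    test function, so its derivative has integral 0. *)
Lemma integration_by_parts_test f psi i : C1_on A f -> test_fun A psi ->
  \int[mu]_(x in A) (f x * partial i psi x) =
  - \int[mu]_(x in A) (partial i f x * psi x).
Proof.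
move=> cf tpsi; have [cpsi [K [cK KA psi0]]] := tpsi.
have tp : test_fun A ((f \* psi) \_ A).
  split.
    apply: (C1_on_patch oA (compact_rV_closed cK) KA).
      by move=> x _ /psi0 /= ->; rewrite mulr0.
    by apply: C1_onM => //; exact: C1_on_sub cpsi.
  exists K; split => // x /psi0 px; rewrite patchE; case: ifPn => //= _.
  by rewrite px mulr0.
have := integral_test_fun_partial i oA tp.
rewrite (@eq_Rintegral _ _ _ mu A (fun x => f x * partial i psi x + partial i f x * psi x)); last first.
  move=> x /[!inE] Ax; rewrite partial_patch// partialM; last 2 first.
  - by case: (cf x Ax).
  - by case: (cpsi x I).
  by rewrite [psi x * _]mulrC.
rewrite RintegralD//.
- by move/eqP; rewrite addr_eq0 => /eqP.
- by apply: test_funM_partial_integrable => //; exact: C1_on_continuous_on.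
- by apply: test_funM_integrable => //; exact: C1_on_partial_continuous_on.
Qed.

(** The derivative is moved from [psi] back to the gradient of [w], which produces the Laplacian.
    The compact support of [psi] provides integrability, whatever [w] does near the boundary. *)
Lemma harmonic_test w psi : harmonic_on A w -> test_fun A psi ->
  \sum_(i < n) \int[mu]_(x in A) (partial i w x * partial i psi x) = 0.
Proof.
move=> [[cw c2w] lw] tpsi.
under eq_bigr => i _ do rewrite integration_by_parts_test//.
rewrite sumrN -Rintegral_sum//; last first.
  move=> i; apply: test_funM_integrable => //.
  exact: C1_on_partial_continuous_on.
rewrite (@eq_Rintegral _ _ _ mu A (cst 0)) ?Rintegral_cst ?mul0r ?oppr0//.
by move=> x /[!inE] Ax; rewrite -mulr_suml; have := lw x Ax; rewrite /laplacian => ->; rewrite mul0r.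
Qed.

(* Integrate psi^2 <= 2 d_i(x_i psi^2) + 4 L^2 (d_i psi)^2: the first term on the
   right has integral 0. *)
Lemma poincare_test (i : 'I_n) (L : R) psi : A `<=` cube L -> test_fun A psi ->
  \int[mu]_(x in A) (psi x ^+ 2) <=
  4 * L ^+ 2 * \int[mu]_(x in A) (partial i psi x ^+ 2).
Proof.
move=> AL tpsi; have [cpsi _] := tpsi.
pose X (x : 'rV[R]_n) := x ord0 i.
have oT := @openT 'rV[R]_n.
have cX : C1_on setT X by exact: C1_on_coord.
have tX : test_fun A (X \* (psi \* psi)).
  by apply: test_funMl => //; exact: test_funMl.
have [_ ip2] := test_fun_L2 tpsi; have [_ idp2] := test_fun_partial_L2 i tpsi.
have iX : mu.-integrable A (EFin \o partial i (X \* (psi \* psi))).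
  apply: compactly_supported_integrable; first exact: test_fun_partial_supported.
  exact: test_fun_partial_continuous.
have E := integral_test_fun_partial i oA tX.
have -> : 4 * L ^+ 2 * \int[mu]_(x in A) (partial i psi x ^+ 2) =
    \int[mu]_(x in A) (2 * partial i (X \* (psi \* psi)) x + 4 * L ^+ 2 * partial i psi x ^+ 2).
  rewrite RintegralD//; [|exact: integrableZl_EFin|exact: integrableZl_EFin].
  by rewrite !RintegralZl// E mulr0 add0r.
apply: le_Rintegral => //.
  by apply: integrableD_EFin; [|exact: integrableZl_EFin|exact: integrableZl_EFin].
move=> x Ax; have [dpsi _] := cpsi x I; have [dX _] := cX x I.
rewrite partialM//; last exact: differentiableM.
rewrite partialM// /X partial_coord eqxx mulr1.
have := AL x Ax i; rewrite ler_norml => /andP[? ?].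
have xL : x ord0 i ^+ 2 <= L ^+ 2 by nra.
set a := x ord0 i in xL *; set p := psi x; set q := partial i psi x.
have := sqr_ge0 (p + 2 * a * q); have := sqr_ge0 q; rewrite /= -/p.
move=> q2 H; have : 0 <= (L ^+ 2 - a ^+ 2) * q ^+ 2 by rewrite mulr_ge0// subr_ge0.
nra.
Qed.

End energy.

(** * The fundamental lemma of the calculus of variations *)

Section fundamental_lemma.
Context {R : realType} {n : nat}.
Implicit Types (g psi : 'rV[R]_n -> R) (A V : set 'rV[R]_n).
Local Notation mu := (lebesgue_rV n).

Lemma measurable_rV_openE : @measurable _ 'rV[R]_n = <<s [set V : set 'rV[R]_n | open V] >>.
Proof.
apply/seteqP; split; last first.
  apply: smallest_sub; first exact: sigma_algebra_measurable.
  by move=> V /= oV; exact: measurable_open_rV.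
apply: smallest_sub; first exact: smallest_sigma_algebra.
move=> B; rewrite -bigcup_seq => -[i _ [Y mY <-]].
pose T' := g_sigma_algebraType [set V : set 'rV[R]_n | open V].
suff mi : measurable_fun [set: T'] (@rV_coord R n i : T' -> R) by exact: mi.
apply: (measurability _ (RGenOInfty.measurableE R)) => _ [_ [y ->] <-].
apply: sub_sigma_algebra; rewrite /= setTI.
apply: open_comp; last exact: rray_open.
by move=> x _; apply: C1_on_continuous (@C1_on_coord _ _ setT i) _.
Qed.

(** The sets over which [h] has integral 0 form a Dynkin class, and the open sets are stable under
    intersection and generate the sigma-algebra. *)
Lemma integral_open_eq0 (h : 'rV[R]_n -> \bar R) : mu.-integrable setT h ->
  (forall V, open V -> \int[mu]_(x in V) h x = 0)%E ->
  {ae mu, forall x, h x = 0%E}.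
Proof.
move=> ih h0.
have H : forall E, measurable E -> (\int[mu]_(x in E) h x = 0)%E.
  move=> E; rewrite measurable_rV_openE; move: E.
  apply: (@dynkin_induction _ _ _ (fun E => (\int[mu]_(x in E) h x = 0)%E) measurable_rV_openE) => //.
  - by move=> U V; exact: openI.
  - by apply: h0; exact: openT.
  - move=> S mS hS.
    have := h0 _ openT; rewrite -(setUv S) integral_setU//.
    + by rewrite hS add0e.
    + exact: measurableC.
    + by apply: measurable_funTS; exact: measurable_int ih.
    + by apply/disj_setPS; rewrite setICr.
  - move=> F mF tF hF; rewrite integral_bigcup//.
      by apply: eseries0 => i _ _.
    by apply: integrableS ih => //; exact: bigcup_measurable.
have : ae_eq mu setT h (cst 0%E).
  apply: integral_ae_eq => // E _ mE; rewrite H// integral0//.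
by apply: filterS => x; exact.
Qed.

(** [g] is integrable only against test functions, so it is first multiplied by a bump, which gives
    an integrable function on the whole space. At each point of [A] some bump is positive, and there
    are countably many of them. *)
Lemma fundamental_lemma A g : open A -> measurable_fun A g ->
  (forall psi, test_fun A psi -> mu.-integrable A (EFin \o (fun x => g x * psi x))) ->
  (forall psi, test_fun A psi -> \int[mu]_(x in A) (g x * psi x) = 0) ->
  {ae mu, forall x, A x -> g x = 0}.
Proof.
move=> oA mg ig g0; have mA := measurable_open_rV oA.
have [b [tb mb b0 bA]] := open_bumps oA.
have H j : {ae mu, forall x, A x -> g x * b j x = 0}.
  pose h := (EFin \o (fun x => g x * b j x)) \_ A.
  have ih : mu.-integrable setT h by apply/(integrable_mkcond _ mA); exact: ig.
  suff : {ae mu, forall x, h x = 0%E}.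
    by apply: filterS => x; rewrite /h patchE => + Ax; rewrite mem_set// => -[].
  apply: integral_open_eq0 => // V oV.
  have [psi [tpsi psi01 psi1]] := open_indicator_approx oV.
  have mV := measurable_open_rV oV.
  (* A bump times [psi k] is again a test function of [A], so each [f_ k] has integral 0; domination
     by |h| lets [psi k] tend to the indicator of [V]. *)
  pose f_ k x := (h x * (psi k x)%:E)%E.
  pose f := h \_ V.
  have mh : measurable_fun setT h by exact: measurable_int ih.
  have [_ _] : [/\ mu.-integrable setT f,
      [sequence (\int[mu]_x `|f_ k x - f x|)%E]_k @ \oo --> 0%E &
      [sequence (\int[mu]_x f_ k x)%E]_k @ \oo --> (\int[mu]_x f x)%E].
    apply: (@dominated_convergence _ _ _ mu setT measurableT f_ f (abse \o h)).
    - move=> k; apply: emeasurable_funM => //; apply: measurableT_comp => //.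
      apply: continuous_on_measurable; first exact: openT.
      exact: test_fun_continuous (test_fun_sub (@subsetT _ V) (tpsi k)).
    - exact/(measurable_restrictT _ mV)/measurable_funTS.
    - apply: aeW => x _; rewrite /f patchE; case: ifPn => [/[!inE] Vx|].
        apply: cvg_near_cst; apply: filterS (psi1 x Vx) => k px.
        by rewrite /f_ px mule1.
      rewrite notin_setE => nVx; apply: cvg_near_cst; near=> k.
      have [_ [K [_ KV pK]]] := tpsi k.
      by rewrite /f_ pK ?mule0// => /KV.
    - exact: integrable_abse.
    - apply: aeW => x k _; rewrite /f_ abseM -[leRHS]mule1 lee_wpmul2l//.
      have /andP[p0 p1] := psi01 k x.
      by rewrite /= lee_fin ger0_norm.
  have fk0 k : (\int[mu]_x f_ k x = 0)%E.
    have tk : test_fun A (b j \* psi k).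
      have [cb _] := tb j; have [K bK] := (tb j).2.
      split; first by apply: C1_onM; [exact: openT|exact: cb|by case: (tpsi k)].
      by exists K; case: bK => cK KA bK; split => // x /bK /= ->; rewrite mul0r.
    have -> : f_ k = (EFin \o (fun x => g x * (b j \* psi k) x)) \_ A.
      apply/funext => x; rewrite /f_ /h !patchE; case: ifPn => _; last by rewrite mul0e.
      by rewrite /= -EFinM mulrA.
    rewrite -integral_mkcond -[LHS]fineK.
      by rewrite -[fine _]/(Rintegral mu A (fun x => g x * (b j \* psi k) x)) g0.
    by apply: integrable_fin_num => //; exact: ig.
  move=> /cvg_lim; rewrite /f -integral_mkcond => <-//.
  rewrite (_ : [sequence _]_k = cst 0%E) ?lim_cst//.
  by apply/funext => k; exact: fk0.
have : {ae mu, forall x, forall j, A x -> g x * b j x = 0} by exact: ae_foralln.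
apply: filterS => x gb Ax; have [j bj] := bA x Ax.
by have /eqP := gb j Ax; rewrite mulf_eq0 [b j x == 0]gt_eqF// orbF => /eqP.
Unshelve. all: by end_near. Qed.

End fundamental_lemma.

(** * Behaviour at the boundary, and a C^1 smoothing of the maximum *)

Section boundary.
Context {R : realType} {n : nat}.
Implicit Types (f P : 'rV[R]_n -> R) (A K : set 'rV[R]_n).

Lemma bdry_open A x : open A -> bdry A x -> ~ A x.
Proof. by move=> oA [_ nAx] Ax; apply: nAx; exact: open_nbhs_nbhs. Qed.

Lemma closure_bdry A x : closure A x -> ~ A x -> bdry A x.
Proof. by move=> cAx nAx; split => // /interior_subset. Qed.

Lemma bounded_closure_compact A : bounded_set A -> compact (closure A).
Proof.
move=> bA; have [L AL] := bounded_cube bA.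
apply: bounded_closed_compact; last exact: closed_closure.
have cC : closed (@cube R n L).
  rewrite (_ : cube L = \bigcap_(j : 'I_n) [set x | `|x ord0 j| <= L]); last first.
    by apply/seteqP; split => x /= xL j => [_|]; apply: xL.
  apply: closed_bigI => j _.
  apply: (@closed_comp _ _ (fun x : 'rV[R]_n => `|x ord0 j|) [set t | t <= L]); last exact: closed_le.
  move=> x _; apply: continuous_comp; last exact: norm_continuous.
  by apply: C1_on_continuous (@C1_on_coord _ _ setT j) _.
have cAL : closure A `<=` @cube R n L by rewrite closureE; apply: smallest_sub.
exists (`|L| + 1); split; first exact: num_real.
move=> M hM x /= /cAL xL; rewrite /Num.Def.normr/= mx_normrE bigmax_le//=.
  by apply: le_trans (ltW hM); rewrite addr_ge0.
move=> [j i] _ /=; rewrite (ord1 j); apply: le_trans (xL i) _.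
by rewrite (le_trans (ler_norm L))// (le_trans _ (ltW hM))// lerDl.
Qed.

(** The points of the closure where |f| >= k form a closed subset of a compact set, and this subset
    misses the boundary, where [f] is 0. *)
Lemma continuous_bdry0_small A f k : open A -> bounded_set A ->
  {within closure A, continuous f} -> (forall x, bdry A x -> f x = 0) ->
  0 < k -> small_at_bdry A f k.
Proof.
move=> oA bA /subspace_continuousP cf f0 k0.
exists (closure A `&` [set x | k <= `|f x|]); split.
- apply: (subclosed_compact _ (bounded_closure_compact bA)); last by move=> x [].
  move=> x clx; have clAx : closure A x.
    by apply: (@closed_closure _ A); apply: closure_subset clx => y [].
  split => //=; rewrite leNgt; apply/negP => fxk.
  have : \forall y \near within (closure A) (nbhs x), `|f y| < k.
    apply: (cf x clAx [set t | `|t| < k]).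
    have : open [set t : R | `|t| < k].
      rewrite (_ : [set _ | _] = (fun t : R => `|t|) @^-1` [set t | t < k])//.
      by apply: open_comp; [move=> t _; exact: norm_continuous|exact: open_lt].
    by move=> oB; apply: open_nbhs_nbhs.
  rewrite /within /= => /clx[y [[clAy kfy] /(_ clAy)]] /=.
  by rewrite ltNge kfy.
- move=> x [clAx kfx]; apply: contrapT => nAx.
  by move: kfx; rewrite /= (f0 x (closure_bdry clAx nAx)) normr0 leNgt k0.
- move=> x Ax nK; rewrite leNgt; apply/negP => kfx; apply: nK; split => /=.
    exact: subset_closure.
  exact: ltW.
Qed.

Lemma continuous_within_bounded A f : bounded_set A ->
  {within closure A, continuous f} -> exists M : R, forall x, A x -> `|f x| <= M.
Proof.
move=> bA cf; have /compact_bounded[M [_ MK]] : compact (f @` closure A).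
  by apply: continuous_compact => //; exact: bounded_closure_compact.
exists (M + 1) => x Ax; apply: MK; first by rewrite ltrDl.
by exists x => //; exact: subset_closure.
Qed.

Lemma continuous_within_max_plus A k (w : 'I_k -> 'rV[R]_n -> R) :
  (forall i, {within A, continuous (w i)}) -> {within A, continuous (max_plus w)}.
Proof.
elim: k w => [|k IH] w cw.
  rewrite (_ : max_plus w = cst 0); first by move=> x; exact: cst_continuous.
  by apply/funext => x; rewrite /max_plus big_ord0.
rewrite (_ : max_plus w = w ord0 \max max_plus (fun i => w (lift ord0 i))).
  by move=> x; apply: continuous_max; [exact: cw|exact: IH].
by apply/funext => x; rewrite /max_plus big_ord_recl.
Qed.

Lemma max_plus_ge0 k (w : 'I_k -> 'rV[R]_n -> R) x : 0 <= max_plus w x.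
Proof. by rewrite /max_plus; elim/big_rec: _ => // i y _ y0; rewrite le_max y0 orbT. Qed.

Lemma max_plus_ge k (w : 'I_k -> 'rV[R]_n -> R) i x : w i x <= max_plus w x.
Proof. exact: (le_bigmax _ (fun i => w i x)). Qed.

Lemma max_plus_le k (w : 'I_k -> 'rV[R]_n -> R) x (c : R) :
  0 <= c -> (forall i, w i x <= c) -> max_plus w x <= c.
Proof. by move=> c0 wc; exact: bigmax_le. Qed.

(** Recursion on max (a, b) = b + (a - b)^+, with [softplus] for the positive part. Each step makes
    the new gradient a convex combination of two old ones, and half of [e] pays for the recursion,
    half for the new [softplus]. *)
Lemma smooth_max_plus A k (w : 'I_k -> 'rV[R]_n -> R) (e : R) : open A -> 0 < e ->
  (forall i, C1_on A (w i)) -> exists U, [/\ C1_on A U,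
    forall x, `|U x - max_plus w x| <= e &
    forall j x, A x -> partial j U x ^+ 2 <= \sum_(i < k) partial j (w i) x ^+ 2].
Proof.
move=> oA; elim: k w e => [|k IH] w e e0 cw.
  exists (cst 0); split; first exact: C1_on_cst.
    by move=> x; rewrite /max_plus big_ord0 subr0 normr0 ltW.
  by move=> j x _; rewrite partial_cst big_ord0 expr0n.
have e2 : 0 < e / 2 by rewrite divr_gt0.
have [V [cV VM dV]] := IH (fun i => w (lift ord0 i)) _ e2 (fun i => cw _).
have cB : C1_on A (w ord0 \- V) by apply: C1_onB.
have ds t : is_derive t (1 : R) (softplus (e / 2)) (dsoftplus (e / 2) t).
  by apply: is_derive_softplus; rewrite gt_eqF.
have cs : C1_on A (softplus (e / 2) \o (w ord0 \- V)).
  by apply: C1_on_comp ds (@continuous_dsoftplus _ _) cB.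
exists (V \+ (softplus (e / 2) \o (w ord0 \- V))); split.
- exact: C1_onD.
- move=> x; rewrite /max_plus big_ord_recl /=.
  have := VM x; rewrite /max_plus; set M := \big[_/_]_(_ < k) _.
  have := softplus_approx (w ord0 x - V x) e2; rewrite !ler_norml.
  by case: (leP 0 (w ord0 x - V x)); case: (leP (w ord0 x) M) => ? ? /andP[? ?] /andP[? ?];
    apply/andP; split; lra.
- move=> j x Ax; have [dw _] := cw ord0 x Ax; have [dVx _] := cV x Ax.
  have [dB _] := cB x Ax; have [dS _] := cs x Ax.
  rewrite partialD// (@partial_comp _ _ _ _ (dsoftplus (e / 2) (w ord0 x - V x)))//.
  rewrite partialB// big_ord_recl; have := dV j x Ax.
  have := dsoftplus_ge0 (w ord0 x - V x) e2; have := dsoftplus_le1 (w ord0 x - V x) e2.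
  set s := dsoftplus _ _; set a := partial j V x; set b := partial j (w ord0) x.
  set S := \sum_(_ < k) _ => s1 s0 aS.
  (* The new derivative is (1 - s) a + s b, and this term is the gap in the convexity inequality for
     its square. *)
  have H : 0 <= s * (1 - s) * (a - b) ^+ 2.
    by rewrite mulr_ge0 ?sqr_ge0// mulr_ge0// subr_ge0.
  by have := mulr_ge0 s0 (sqr_ge0 a); have := mulr_ge0 (_ : 0 <= 1 - s) (sqr_ge0 b); nra.
Qed.

End boundary.

(** * H^1 approximation by C^1 functions with exact boundary values *)

Section H1_approximation.
Context {R : realType} {n : nat}.
Implicit Types (f u v P psi phi : 'rV[R]_n -> R) (G : 'I_n -> 'rV[R]_n -> R).
Local Notation mu := (lebesgue_rV n).
Variable A : set 'rV[R]_n.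
Hypotheses (oA : open A) (bA : bounded_set A).

Let mA : measurable A. Proof. exact: measurable_open_rV. Qed.
Let Afin : (mu A < +oo)%E. Proof. exact: bounded_lebesgue_rV. Qed.

Lemma in_Lp2_L2 f : in_Lp 2%:E A f -> L2 mu A f.
Proof.
rewrite /in_Lp => Lf; have i2 := Lfun2_integrable_sqr Lf.
have mf : measurable_fun setT (f \_ A).
  by move: Lf; rewrite inE => /andP[]; rewrite inE.
split; first exact/(measurable_restrictT _ mA).
apply/(integrable_mkcond _ mA); rewrite (_ : _ \_ A = EFin \o (fun x => (f \_ A) x ^+ 2))//.
by apply/funext => x; rewrite /= !patchE; case: ifPn => //= _; rewrite expr0n.
Qed.

Lemma Lp_norm2_lt f (e : R) : L2 mu A f -> (Lp_norm 2%:E A f < e%:E)%E ->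
  \int[mu]_(x in A) (f x ^+ 2) <= e ^+ 2.
Proof.
move=> [mf if2] fe; have e0 : 0 <= e.
  by rewrite -lee_fin (le_trans _ (ltW fe))// Lnorm_ge0.
rewrite -lee_fin; have ifin := integrable_fin_num mA if2.
rewrite /Rintegral fineK//.
have : (Lp_norm 2%:E A f `^ 2 <= (e ^+ 2)%:E)%E.
  by rewrite -powR_mulrn// -poweR_EFin gt0_ler_poweR// ?in_itv/= ?leey ?andbT ?Lnorm_ge0// ltW.
apply: le_trans; rewrite /Lp_norm powR_Lnorm ?pnatr_eq0// integral_mkcond.
rewrite le_eqVlt; apply/orP; left; apply/eqP; apply: eq_integral => x _.
rewrite patchE /= patchE; case: ifPn => _ /=.
  by rewrite powR_mulrn// -normrX ger0_norm ?sqr_ge0.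
by rewrite [X in `|X|](_ : _ = 0)// normr0 powR0// pnatr_eq0.
Qed.

Lemma C1_bounded_L2 P : C1_on setT P -> L2 mu A P /\ forall j, L2 mu A (partial j P).
Proof.
move=> cP; have cc := bounded_closure_compact bA.
have L2c g : continuous_on setT g -> L2 mu A g.
  move=> cg; apply: L2_bounded => //.
    by apply: continuous_on_measurable => // x _; exact: cg.
  have [M _ gM] := continuous_compact_bounded cc (fun x _ => cg x I).
  by exists M => x Ax; apply: gM; exact: subset_closure.
split; first by apply: L2c; exact: C1_on_continuous_on.
by move=> j; apply: L2c; exact: C1_on_partial_continuous_on.
Qed.

Lemma H1_grad_L2 u G : H1_grad A u G -> L2 mu A u /\ forall j, L2 mu A (G j).
Proof. by move=> [Lu LG _]; split => [|j]; exact: in_Lp2_L2. Qed.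

(** The only form in which boundary values of Sobolev functions are used from here on. The bounds
    are on the squared L^2 errors. *)
Definition H1_approx u G phi := forall e : R, 0 < e -> exists P,
  [/\ C1_on setT P, forall x, bdry A x -> P x = phi x,
      \int[mu]_(x in A) ((u x - P x) ^+ 2) <= e &
      forall j, \int[mu]_(x in A) ((G j x - partial j P x) ^+ 2) <= e].

Lemma ae_eq_Rintegral f g : measurable_fun A f -> measurable_fun A g ->
  {ae mu, forall x, A x -> f x = g x} ->
  \int[mu]_(x in A) f x = \int[mu]_(x in A) g x.
Proof.
move=> mf mg fg; rewrite /Rintegral; congr fine; apply: ae_eq_integral => //.
- exact: measurableT_comp.
- exact: measurableT_comp.
- by apply: filterS fg => x fg Ax; rewrite fg.
Qed.

Lemma trace_eq_approx u G phi : H1_grad A u G -> trace_eq A u phi -> H1_approx u G phi.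
Proof.
move=> uG [Phi [cPhi Phib [G' vG' appr]]] e e0.
have [Lu LG] := H1_grad_L2 uG; have [Lv LG'] := H1_grad_L2 vG'.
have [LPhi LdPhi] := C1_bounded_L2 cPhi.
(* The gradient [G'] of u - Phi comes from another existential than [G]. Both obey integration by
   parts against all test functions, so the fundamental lemma identifies [G'] with the gradient of u
   - Phi computed from [G]. *)
have aeG j : {ae mu, forall x, A x -> G j x - partial j Phi x - G' j x = 0}.
  have LD : L2 mu A (fun x => G j x - partial j Phi x - G' j x).
    by do 2 apply: L2B => //.
  apply: fundamental_lemma => //; first by case: LD.
    by move=> psi tpsi; apply: L2M => //; exact: test_fun_L2.
  move=> psi tpsi; have Lpsi := test_fun_L2 oA bA tpsi.
  have Ldpsi := test_fun_partial_L2 oA bA j tpsi.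
  have [_ _ /(_ j psi tpsi) ibpu] := uG; have [_ _ /(_ j psi tpsi) ibpv] := vG'.
  have ibpP := integration_by_parts_test oA bA j (C1_on_sub (@subsetT _ A) cPhi) tpsi.
  under eq_Rintegral do rewrite 2!mulrBl.
  rewrite RintegralB//; [|by apply: integrableB_EFin => //; exact: L2M|exact: L2M].
  rewrite RintegralB//; [|exact: L2M|exact: L2M].
  move: ibpv; under eq_Rintegral do rewrite mulrBl.
  rewrite RintegralB//; [|exact: L2M|exact: L2M].
  by rewrite ibpu ibpP; lra.
have s0 : 0 < Num.sqrt e by rewrite sqrtr_gt0.
have [psi [tpsi uapp Gapp]] := appr _ s0.
have [cpsi [K [cK KA psi0]]] := tpsi.
have Lpsi := test_fun_L2 oA bA tpsi.
have oT := @openT 'rV[R]_n.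
have sE : Num.sqrt e ^+ 2 = e by rewrite sqr_sqrtr// ltW.
exists (Phi \+ psi); split.
- exact: C1_onD.
- by move=> x bx; rewrite /= Phib// psi0 ?addr0// => /KA; exact: bdry_open.
- rewrite -[leRHS]sE; apply: le_trans (Lp_norm2_lt (L2B mA Lv Lpsi) uapp).
  by rewrite le_eqVlt; apply/predU1l; apply: eq_Rintegral => x _; rewrite /= opprD addrA.
- move=> j; rewrite -[leRHS]sE.
  have Ldpsi := test_fun_partial_L2 oA bA j tpsi.
  have [_ LdP] := C1_bounded_L2 (C1_onD oT cPhi cpsi).
  apply: le_trans (Lp_norm2_lt (L2B mA (LG' j) Ldpsi) (Gapp j)).
  rewrite le_eqVlt; apply/predU1l; apply: ae_eq_Rintegral.
  + by apply: measurable_funX; case: (L2B mA (LG j) (LdP j)).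
  + by apply: measurable_funX; case: (L2B mA (LG' j) Ldpsi).
  + apply: filterS (aeG j) => x + Ax => /(_ Ax) Gx.
    have [dP _] := cPhi x I; have [dp _] := cpsi x I.
    by rewrite partialD//; congr (_ ^+ 2); lra.
Qed.

Lemma Rintegral_sqrB (f g f' g' : 'rV[R]_n -> R) : L2 mu A f -> L2 mu A g ->
  L2 mu A f' -> L2 mu A g' ->
  \int[mu]_(x in A) ((f x - g x - (f' x - g' x)) ^+ 2) <=
  2 * \int[mu]_(x in A) ((f x - f' x) ^+ 2) + 2 * \int[mu]_(x in A) ((g x - g' x) ^+ 2).
Proof.
move=> Lf Lg Lf' Lg'.
have [_ i1] := L2B mA Lf Lf'; have [_ i2] := L2B mA Lg Lg'.
have [_ i3] := L2B mA (L2B mA Lf Lg) (L2B mA Lf' Lg').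
rewrite -!RintegralZl// -RintegralD//; [|exact: integrableZl_EFin|exact: integrableZl_EFin].
apply: le_Rintegral => //; first by apply: integrableD_EFin => //; exact: integrableZl_EFin.
by move=> x _; have := sqr_ge0 (f x - f' x + (g x - g' x)); nra.
Qed.

Lemma H1_approxB u G phi v H chi : H1_grad A u G -> H1_grad A v H ->
  H1_approx u G phi -> H1_approx v H chi ->
  H1_approx (fun x => u x - v x) (fun j x => G j x - H j x) (fun x => phi x - chi x).
Proof.
(* A quarter, because (a + b)^2 <= 2 a^2 + 2 b^2 doubles each of the two errors. *)
move=> uG vH aG aH e e0; have e4 : 0 < e / 4 by rewrite divr_gt0.
have eE : e = 2 * (e / 4) + 2 * (e / 4) by field.
have [P [cP Pb uP GP]] := aG _ e4; have [Q [cQ Qb vQ HQ]] := aH _ e4.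
have [Lu LG] := H1_grad_L2 uG; have [Lv LH] := H1_grad_L2 vH.
have [LP LdP] := C1_bounded_L2 cP; have [LQ LdQ] := C1_bounded_L2 cQ.
exists (P \- Q); split.
- by apply: C1_onB => //; exact: openT.
- by move=> x bx; rewrite /= Pb// Qb.
- apply: le_trans (Rintegral_sqrB Lu Lv LP LQ) _.
  by rewrite eE lerD// ler_pM2l.
- move=> j; under eq_Rintegral => x _.
    rewrite partialB; [over|by case: (cP x I)|by case: (cQ x I)].
  apply: le_trans (Rintegral_sqrB (LG j) (LH j) (LdP j) (LdQ j)) _.
  by rewrite eE lerD// ler_pM2l.
Qed.

End H1_approximation.

(** * Uniqueness for the Dirichlet problem, and weak derivatives of C^1 functions *)

Section dirichlet.
Context {R : realType} {n : nat}.
Implicit Types (f u v w P psi phi : 'rV[R]_n.+1 -> R) (G : 'I_n.+1 -> 'rV[R]_n.+1 -> R).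
Local Notation mu := (lebesgue_rV n.+1).
Variable A : set 'rV[R]_n.+1.
Hypotheses (oA : open A) (bA : bounded_set A).

Let mA : measurable A. Proof. exact: measurable_open_rV. Qed.
Let Afin : (mu A < +oo)%E. Proof. exact: bounded_lebesgue_rV. Qed.
Let oT := @openT 'rV[R]_n.+1.

Lemma within_continuous_L2 f : continuous_on A f ->
  {within closure A, continuous f} -> L2 mu A f.
Proof.
move=> cf cwf; apply: L2_bounded => //; first exact: continuous_on_measurable.
exact: continuous_within_bounded.
Qed.

Lemma small_at_bdryB P w k : C1_on setT P -> {within closure A, continuous w} ->
  (forall x, bdry A x -> P x = w x) -> 0 < k -> small_at_bdry A (P \- w) k.
Proof.
move=> cP cw Pw k0; apply: continuous_bdry0_small => //.
  have cP' : {within closure A, continuous P}.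
    by apply: continuous_subspaceT => x; exact: C1_on_continuous cP I.
  by move=> x; apply: continuousB; [exact: cP'|exact: cw].
by move=> x bx; rewrite /= Pw// subrr.
Qed.

Lemma small_square_sequence (V e : R) : 0 <= V -> 0 < e ->
  exists2 k : R, 0 < k & k ^+ 2 * V <= e.
Proof.
move=> V0 e0; have V1 : 0 < V + 1 by rewrite ltr_wpDl.
exists (Num.sqrt (e / (V + 1))); first by rewrite sqrtr_gt0 divr_gt0.
rewrite sqr_sqrtr; last by rewrite ltW// divr_gt0.
by rewrite mulrAC ler_pdivrMr//; nra.
Qed.

(** As [w] is not known to lie in H^1, v - w cannot be tested directly. The truncation of P - w can;
    its energy is of the order of the approximation error, and Poincare turns this into an L^2
    bound. *)
Lemma weakly_harmonic_unique v G phi w : L2 mu A v -> (forall j, L2 mu A (G j)) ->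
  H1_approx A v G phi ->
  (forall psi, test_fun A psi ->
    \sum_(j < n.+1) \int[mu]_(x in A) (G j x * partial j psi x) = 0) ->
  harmonic_on A w -> {within closure A, continuous w} ->
  (forall x, bdry A x -> w x = phi x) ->
  {ae mu, forall x, A x -> v x = w x}.
Proof.
move=> Lv LG vapp vw hw cw wphi; have [[cw1 _] _] := hw.
have Lw : L2 mu A w by apply: within_continuous_L2 => //; exact: C1_on_continuous_on.
have [L AL] := bounded_cube bA.
pose V := \int[mu]_(x in A) (1 : R).
have V0 : 0 <= V by apply: Rintegral_ge0.
(* From (a + b + c)^2 <= 3 (a^2 + b^2 + c^2): 3 for v - P, 12 L^2 (n+1) for the truncation via
   Poincare, 12 = 3 * 2^2 for the truncation error 2 k, with k^2 |A| <= e. *)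
have bound e : 0 < e -> \int[mu]_(x in A) ((v x - w x) ^+ 2) <=
    (3 + 12 + 12 * L ^+ 2 * n.+1%:R) * e.
  move=> e0; have [P [cP Pb vP GP]] := vapp e e0.
  have [k k0 kV] := small_square_sequence V0 e0.
  have [LP LdP] := C1_bounded_L2 oA bA cP.
  pose F := P \- w.
  have cF : C1_on A F by apply: C1_onB => //; exact: C1_on_sub cP.
  have sF : small_at_bdry A F k.
    by apply: small_at_bdryB => // x bx; rewrite Pb// wphi.
  pose eta := (trunc k \o F) \_ A.
  have teta : test_fun A eta by exact: test_fun_trunc.
  have Leta := test_fun_L2 oA bA teta.
  have Ldeta j := test_fun_partial_L2 oA bA j teta.
  have dP x : differentiable P x by case: (cP x I).
  have iwd j : mu.-integrable A (EFin \o (fun x => partial j w x * partial j eta x)).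
    by apply: test_funM_partial_integrable => //; exact: C1_on_partial_continuous_on.
  have iGd j : mu.-integrable A (EFin \o (fun x => G j x * partial j eta x)).
    exact: L2M.
  have iGP j : mu.-integrable A (EFin \o (fun x => (G j x - partial j P x) ^+ 2)).
    by case: (L2B mA (LG j) (LdP j)).
  have denergy : \sum_(j < n.+1) \int[mu]_(x in A) (partial j eta x ^+ 2) <= n.+1%:R * e.
    (* With b = dtrunc k (P - w) in [0, 1] this is the pointwise inequality
       (d eta)^2 <= 2 (G - dw) d eta + (G - dP)^2 for d eta = b (dP - dw). *)
    have H j : \int[mu]_(x in A) (partial j eta x ^+ 2) <=
        2 * (\int[mu]_(x in A) (G j x * partial j eta x) -
             \int[mu]_(x in A) (partial j w x * partial j eta x)) +
        \int[mu]_(x in A) ((G j x - partial j P x) ^+ 2).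
      rewrite -RintegralB// -RintegralZl//; last exact: integrableB_EFin.
      rewrite -RintegralD//; last by apply: integrableZl_EFin => //; exact: integrableB_EFin.
      apply: le_Rintegral => //; first by case: (Ldeta j).
        by apply: integrableD_EFin => //; apply: integrableZl_EFin => //; exact: integrableB_EFin.
      move=> x Ax; rewrite partial_trunc// partialB//; last by case: (cw1 x Ax).
      have := dtrunc_ge0 (F x) k0; have := dtrunc_le1 (F x) k0.
      set b := dtrunc _ _; set p := partial j P x; set q := partial j w x; set g := G j x.
      move=> b1 b0; have H : 0 <= 2 * (b * (1 - b)) * (p - q) ^+ 2.
        by rewrite mulr_ge0 ?sqr_ge0// mulr_ge0// mulr_ge0// subr_ge0.
      by have := sqr_ge0 (b * (p - q) + (g - p)); nra.
    apply: le_trans (ler_sum (P := xpredT) _ (fun j _ => H j)) _.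
    (* Summed over [j], the cross terms vanish: [G] and the gradient of [w] are both orthogonal to
       gradients of test functions. *)
    rewrite big_split/= -mulr_sumr sumrB vw// harmonic_test// subrr mulr0 add0r.
    apply: le_trans (ler_sum (P := xpredT) _ (fun j _ => GP j)) _.
    by rewrite sumr_const card_ord mulr_natl.
  have eta2 : \int[mu]_(x in A) (eta x ^+ 2) <= 4 * L ^+ 2 * (n.+1%:R * e).
    apply: le_trans (poincare_test oA bA ord0 AL teta) _.
    apply: ler_wpM2l; first by rewrite mulr_ge0// sqr_ge0.
    apply: le_trans denergy.
    rewrite big_ord_recl lerDl sumr_ge0// => j _; apply: Rintegral_ge0 => x _.
    exact: sqr_ge0.
  have [_ ivP] := L2B mA Lv LP; have [_ ieta] := Leta.
  have i1 : mu.-integrable A (EFin \o (fun=> 1 : R)).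
    by apply: bounded_integrable => //; exists 1 => // x _; rewrite normr1.
  have [_ ivw] := L2B mA Lv Lw.
  have : \int[mu]_(x in A) ((v x - w x) ^+ 2) <=
     3 * (\int[mu]_(x in A) ((v x - P x) ^+ 2) + \int[mu]_(x in A) (eta x ^+ 2)) +
     12 * k ^+ 2 * V.
    rewrite -RintegralD// -!RintegralZl//; last exact: integrableD_EFin.
    rewrite -RintegralD//; [|by apply: integrableZl_EFin => //; exact: integrableD_EFin|exact: integrableZl_EFin].
    apply: le_Rintegral => //.
      by apply: integrableD_EFin; [|apply: integrableZl_EFin => //; exact: integrableD_EFin|exact: integrableZl_EFin].
    move=> x Ax; have := trunc_approx (F x) k0.
    rewrite /eta patchE mem_set// -[(trunc k \o F) x]/(trunc k (F x)) -[F x]/(P x - w x).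
    set t := trunc _ _; rewrite ler_norml => /andP[h1 h2].
    set a := v x; set p := P x in t h1 h2 *; set q := w x in t h1 h2 *.
    have H : (t - (p - q)) ^+ 2 <= 4 * k ^+ 2 by nra.
    have := sqr_ge0 ((a - p) - t); have := sqr_ge0 ((a - p) + (t - (p - q))).
    by have := sqr_ge0 (t + (t - (p - q))); nra.
  move=> /le_trans; apply.
  nra.
have [_ ivw] := L2B mA Lv Lw.
have vw0 : \int[mu]_(x in A) ((v x - w x) ^+ 2) <= 0.
  set C := 3 + 12 + 12 * L ^+ 2 * n.+1%:R in bound.
  have C0 : 0 < C by rewrite ltr_pwDl// mulr_ge0// mulr_ge0// sqr_ge0.
  apply/ler_addgt0Pr => e e0; rewrite add0r.
  have := bound (e / C) (divr_gt0 e0 C0); rewrite mulrCA mulfV ?mulr1//.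
  by rewrite gt_eqF.
have iabs : (\int[mu]_(x in A) `|((v x - w x) ^+ 2)%:E| = 0)%E.
  under eq_integral do rewrite gee0_abs ?lee_fin ?sqr_ge0//.
  rewrite -[LHS]fineK; last exact: (integrable_fin_num mA ivw).
  congr EFin; apply/eqP; rewrite eq_le vw0/=.
  by apply: Rintegral_ge0 => x _; exact: sqr_ge0.
have := (ae_eq_integral_abs mu mA (measurable_int _ ivw)).1 iabs.
apply: filterS => x + Ax => /(_ Ax) /= -[/eqP].
by rewrite sqrf_eq0 subr_eq0 => /eqP.
Qed.

(** Integration by parts against test functions determines a derivative almost everywhere. This
    later shows that the classical gradient of a harmonic function is square integrable. *)
Lemma weak_derivative_C1 v g w j : L2 mu A v -> L2 mu A g ->
  (forall psi, test_fun A psi ->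
     \int[mu]_(x in A) (v x * partial j psi x) = - \int[mu]_(x in A) (g x * psi x)) ->
  C1_on A w ->
  {ae mu, forall x, A x -> v x = w x} ->
  {ae mu, forall x, A x -> g x = partial j w x}.
Proof.
move=> Lv Lg ibp cw vw.
have cdw : continuous_on A (partial j w) by exact: C1_on_partial_continuous_on.
have mdw := continuous_on_measurable oA cdw.
have mw := continuous_on_measurable oA (C1_on_continuous_on cw).
suff : {ae mu, forall x, A x -> g x - partial j w x = 0}.
  by apply: filterS => x + Ax => /(_ Ax) /eqP; rewrite subr_eq0 => /eqP.
have iGp psi : test_fun A psi -> mu.-integrable A (EFin \o (fun x => g x * psi x)).
  by move=> tpsi; apply: L2M => //; exact: test_fun_L2.
have iwp psi : test_fun A psi -> mu.-integrable A (EFin \o (fun x => partial j w x * psi x)).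
  by move=> tpsi; exact: test_funM_integrable.
apply: fundamental_lemma => //.
- by apply: measurable_funB => //; case: Lg.
- move=> psi tpsi.
  rewrite (_ : (fun x => _) = (fun x => g x * psi x - partial j w x * psi x)).
    by apply: integrableB_EFin => //; [exact: iGp|exact: iwp].
  by apply/funext => x; rewrite mulrBl.
- move=> psi tpsi; under eq_Rintegral do rewrite mulrBl.
  rewrite RintegralB//; [|exact: iGp|exact: iwp].
  have := integration_by_parts_test oA bA j cw tpsi; have := ibp psi tpsi.
  rewrite (@ae_eq_Rintegral _ _ _ oA _ (fun x => w x * partial j psi x)).
  + by move=> -> /oppr_inj ->; rewrite subrr.
  + apply: measurable_funM; first by case: Lv.
    by case: (test_fun_partial_L2 oA bA j tpsi).
  + by apply: measurable_funM => //; case: (test_fun_partial_L2 oA bA j tpsi).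
  + by apply: filterS vw => x + Ax => /(_ Ax) ->.
Qed.

Lemma L2_ae_eq f g : L2 mu A f -> measurable_fun A g ->
  {ae mu, forall x, A x -> f x = g x} -> L2 mu A g.
Proof.
move=> [mf if2] mg fg; split => //; apply/integrableP; split.
  by apply: measurableT_comp => //; exact: measurable_funX.
move/integrableP : if2 => [_]; apply: le_lt_trans.
rewrite le_eqVlt; apply/predU1l; apply: ge0_ae_eq_integral => //.
- by do 2 apply: measurableT_comp => //; exact: measurable_funX.
- by do 2 apply: measurableT_comp => //; exact: measurable_funX.
- by apply: filterS fg => x + Ax => /(_ Ax) /= ->.
Qed.

End dirichlet.

(** * The energy bound for the reaction term *)

Section reaction.
Context {R : realType} {n : nat}.
Implicit Types (f u w psi phi : 'rV[R]_n.+1 -> R) (G : 'I_n.+1 -> 'rV[R]_n.+1 -> R).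
Local Notation mu := (lebesgue_rV n.+1).
Variable A : set 'rV[R]_n.+1.
Hypotheses (oA : open A) (bA : bounded_set A).

Let mA : measurable A. Proof. exact: measurable_open_rV. Qed.
Let Afin : (mu A < +oo)%E. Proof. exact: bounded_lebesgue_rV. Qed.
Let oT := @openT 'rV[R]_n.+1.

Lemma max_plus_L2 k (w : 'I_k -> 'rV[R]_n.+1 -> R) :
  (forall i, C1_on A (w i)) -> (forall i, {within closure A, continuous (w i)}) ->
  L2 mu A (max_plus w).
Proof.
move=> cw cww; apply: L2_bounded => //; last first.
  by apply: continuous_within_bounded => //; exact: continuous_within_max_plus.
elim: k w cw {cww} => [|k IH] w cw.
  rewrite (_ : max_plus w = cst 0)//.
  by apply/funext => x; rewrite /max_plus big_ord0.
rewrite (_ : max_plus w = w ord0 \max max_plus (fun i => w (lift ord0 i))).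
  apply: measurable_maxr; last by apply: IH => i; exact: cw.
  by apply: continuous_on_measurable => //; exact: C1_on_continuous_on.
by apply/funext => x; rewrite /max_plus big_ord_recl.
Qed.

(** The error terms are at least linear in [e], with constants that may depend on [u] and [f]; as e
    tends to 0 only the energies of the [w i] survive, and these do not see the right-hand side
    [f]. *)
Lemma reaction_energy_bound u G f phi k (w : 'I_k -> 'rV[R]_n.+1 -> R) :
  L2 mu A u -> (forall j, L2 mu A (G j)) -> L2 mu A f -> H1_approx A u G phi ->
  (forall psi, test_fun A psi ->
    \sum_(j < n.+1) \int[mu]_(x in A) (G j x * partial j psi x) =
    - \int[mu]_(x in A) (f x * psi x)) ->
  (forall i, C1_on A (w i)) -> (forall i, {within closure A, continuous (w i)}) ->
  (forall x, bdry A x -> max_plus w x = phi x) ->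
  (forall i j, L2 mu A (partial j (w i))) ->
  \int[mu]_(x in A) (f x * (u x - max_plus w x)) <=
  2^-1 * \sum_(j < n.+1) \sum_(i < k) \int[mu]_(x in A) (partial j (w i) x ^+ 2).
Proof.
move=> Lu LG Lf uapp uf cw cww wphi Ldw; set U := max_plus w.
have LU : L2 mu A U by exact: max_plus_L2.
have cU : {within closure A, continuous U} by exact: continuous_within_max_plus.
pose V := \int[mu]_(x in A) (1 : R).
have V0 : 0 <= V by apply: Rintegral_ge0.
have i1 : mu.-integrable A (EFin \o (fun=> 1 : R)).
  by apply: bounded_integrable => //; exists 1 => // x _; rewrite normr1.
have [_ if2] := Lf; pose F2 := \int[mu]_(x in A) (f x ^+ 2).
have F20 : 0 <= F2 by apply: Rintegral_ge0 => x _; exact: sqr_ge0.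
pose E j := \sum_(i < k) \int[mu]_(x in A) (partial j (w i) x ^+ 2).
have bound e : 0 < e -> \int[mu]_(x in A) (f x * (u x - U x)) <=
    2^-1 * \sum_(j < n.+1) E j +
    e * (2^-1 * n.+1%:R * e + 2^-1 * F2 + 2^-1 * 3 + 15 * 2^-1 * V).
  (* Squared errors of size e^2, because the Young inequality used in [rest] divides them by [e]. *)
  move=> e0; have ee0 : 0 < e ^+ 2 by rewrite exprn_gt0.
  have [P [cP Pb uP GP]] := uapp _ ee0.
  have [LP LdP] := C1_bounded_L2 oA bA cP.
  have e2 : 0 < e / 2 by rewrite divr_gt0.
  have [W [cW WU dW]] := smooth_max_plus oA e2 cw.
  pose F := P \- W.
  have cF : C1_on A F by apply: C1_onB => //; exact: C1_on_sub cP.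
  have sF : small_at_bdry A F e.
    (* One half of [e] bounds P - U near the boundary, the other half the smoothing error U - W. *)
    have [|K [cK KA FK]] := @small_at_bdryB _ _ _ oA bA _ _ (e / 2) cP cU _ e2.
      by move=> x bx; rewrite Pb// -wphi.
    exists K; split => // x Ax nKx; have := FK x Ax nKx; have := WU x.
    by rewrite /F /= -/U !ler_norml => /andP[? ?] /andP[? ?]; apply/andP; split; lra.
  pose eta := (trunc e \o F) \_ A.
  have teta : test_fun A eta by exact: test_fun_trunc.
  have Leta := test_fun_L2 oA bA teta.
  have Ldeta j := test_fun_partial_L2 oA bA j teta.
  have iGP j : mu.-integrable A (EFin \o (fun x => (G j x - partial j P x) ^+ 2)).
    by case: (L2B mA (LG j) (LdP j)).
  have iwj j : mu.-integrable A (EFin \o (fun x => \sum_(i < k) partial j (w i) x ^+ 2)).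
    by apply: integrable_sum_EFin => // i; case: (Ldw i j).
  have iGd j : mu.-integrable A (EFin \o (fun x => G j x * partial j eta x)) by exact: L2M.
  have dP x : differentiable P x by case: (cP x I).
  have feta : \int[mu]_(x in A) (f x * eta x) <=
      2^-1 * \sum_(j < n.+1) E j + 2^-1 * (n.+1%:R * e ^+ 2).
    (* Pointwise, - G b (dP - dW) <= ((dW)^2 + (G - dP)^2) / 2 for 0 <= b <= 1. *)
    have H j : - (\int[mu]_(x in A) (G j x * partial j eta x)) <=
        2^-1 * E j + 2^-1 * \int[mu]_(x in A) ((G j x - partial j P x) ^+ 2).
      rewrite /E -Rintegral_sum//; last by move=> i; case: (Ldw i j).
      rewrite -[leLHS]mulN1r -!RintegralZl// -RintegralD//; [|exact: integrableZl_EFin|exact: integrableZl_EFin].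
      apply: le_Rintegral => //; first exact: integrableZl_EFin.
        by apply: integrableD_EFin => //; exact: integrableZl_EFin.
      move=> x Ax; rewrite partial_trunc// partialB//; last by case: (cW x Ax).
      have := dtrunc_ge0 (F x) e0; have := dtrunc_le1 (F x) e0; have := dW j x Ax.
      set b := dtrunc _ _; set p := partial j P x; set q := partial j W x; set g := G j x.
      set S := \sum_(_ < k) _ => qS b1 b0.
      (* Twice the difference of the two sides, with [S] replaced by [q ^+ 2], is affine in [b] and
         a sum of two squares at b = 1 ([H1]) and at b = 0 ([H2]). *)
      have H1 : 0 <= b * ((q - g) ^+ 2 + p ^+ 2).
        by rewrite mulr_ge0// addr_ge0// sqr_ge0.
      have H2 : 0 <= (1 - b) * (q ^+ 2 + (g - p) ^+ 2).
        by rewrite mulr_ge0 ?subr_ge0// addr_ge0// sqr_ge0.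
      nra.
    rewrite -[leLHS]opprK -uf// -sumrN.
    apply: le_trans (ler_sum (P := xpredT) _ (fun j _ => H j)) _.
    rewrite big_split/= -!mulr_sumr lerD2l ler_pM2l ?invr_gt0//.
    apply: le_trans (ler_sum (P := xpredT) _ (fun j _ => GP j)) _.
    by rewrite sumr_const card_ord mulr_natl.
  have [_ iuP] := L2B mA Lu LP.
  have iuU : mu.-integrable A (EFin \o (fun x => f x * (u x - U x))).
    by apply: L2M => //; exact: L2B.
  have ife : mu.-integrable A (EFin \o (fun x => f x * eta x)) by exact: L2M.
  (* Young with weight [e]: f d <= (e/2) f^2 + d^2/(2 e) for d = u - U - eta. Here d^2 <= 3 (u -
     P)^2 + 15 e^2, where 15 = 3 (2^2 + 1) collects the truncation error 2 e and a smoothing error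
     of at most [e]. *)
  have rest : \int[mu]_(x in A) (f x * (u x - U x)) - \int[mu]_(x in A) (f x * eta x) <=
      e / 2 * F2 + (3 / (2 * e)) * \int[mu]_(x in A) ((u x - P x) ^+ 2) +
      (15 * e / 2) * V.
    rewrite /V /F2 -RintegralB// -!RintegralZl// -RintegralD//; last 2 first.
    - exact: integrableZl_EFin.
    - exact: integrableZl_EFin.
    rewrite -RintegralD//; last 2 first.
    - by apply: integrableD_EFin => //; exact: integrableZl_EFin.
    - exact: integrableZl_EFin.
    apply: le_Rintegral => //; first exact: integrableB_EFin.
      apply: integrableD_EFin => //; last exact: integrableZl_EFin.
      by apply: integrableD_EFin => //; exact: integrableZl_EFin.
    move=> x Ax; have := trunc_approx (F x) e0; have := WU x; rewrite -/U.
    rewrite /eta patchE mem_set// -[(trunc e \o F) x]/(trunc e (F x)) -[F x]/(P x - W x).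
    set t := trunc _ _; set fx := f x; set p := P x; set q := W x; set r := U x.
    rewrite !ler_norml => /andP[h1 h2] /andP[h3 h4]; set a := u x.
    have hd : (a - r - t) ^+ 2 <= 3 * (a - p) ^+ 2 + 15 * e ^+ 2.
      have H1 : (q - r) ^+ 2 <= e ^+ 2 by nra.
      have H2 : (t - (p - q)) ^+ 2 <= 4 * e ^+ 2 by nra.
      have -> : a - r - t = (a - p) - (t - (p - q)) + (q - r) by ring.
      move: H1 H2; set x1 := a - p; set x2 := t - (p - q); set x3 := q - r => H1 H2.
      have := sqr_ge0 (x1 + x2); have := sqr_ge0 (x1 - x3); have := sqr_ge0 (x2 + x3).
      nra.
    rewrite -subr_ge0.
    have -> : e / 2 * fx ^+ 2 + 3 / (2 * e) * (a - p) ^+ 2 + 15 * e / 2 * 1 -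
        (fx * (a - r) - fx * t) =
        ((e * fx - (a - r - t)) ^+ 2 +
         (3 * (a - p) ^+ 2 + 15 * e ^+ 2 - (a - r - t) ^+ 2)) / (2 * e).
      by field; rewrite gt_eqF.
    rewrite divr_ge0// ?mulr_ge0// ?(ltW e0)// addr_ge0 ?sqr_ge0// subr_ge0.
    exact: hd.
  have : (3 / (2 * e)) * \int[mu]_(x in A) ((u x - P x) ^+ 2) <= 3 / 2 * e.
    have -> : 3 / 2 * e = 3 / (2 * e) * e ^+ 2.
      by rewrite invfM -!mulrA; congr (_ * (_ * _)); rewrite expr2 mulrA mulVf ?mul1r ?gt_eqF.
    by apply: ler_wpM2l => //; rewrite divr_ge0// mulr_ge0// ltW.
  by move=> H3; nra.
set C := 2^-1 * n.+1%:R + 2^-1 * F2 + 2^-1 * 3 + 15 * 2^-1 * V.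
have C0 : 0 < C.
  by rewrite /C; have : 0 <= n.+1%:R :> R by []; lra.
(* The cap at 1 absorbs the term of [bound] that is quadratic in its parameter into the constant
   [C]. *)
apply/ler_addgt0Pr => e e0; pose d := Num.min 1 (e / C).
have d0 : 0 < d by rewrite lt_min ltr01 divr_gt0.
have d1 : d <= 1 by rewrite ge_min lexx.
have dC : d * C <= e by rewrite -ler_pdivlMr// ge_min lexx orbT.
apply: le_trans (bound d d0) _; rewrite lerD2l; apply: le_trans dC.
by rewrite ler_pM2l// /C !lerD2r ler_piMr.
Qed.

End reaction.

(** * Essential bounds and L^p norms *)

Section bounded_ae.
Context {R : realType} {n : nat}.
Local Notation mu := (lebesgue_rV n).
Implicit Types (f : 'rV[R]_n -> R) (A : set 'rV[R]_n).

Lemma in_Lpy_ae_bounded A f : measurable A -> in_Lp +oo%E A f ->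
  exists2 M : R, 0 <= M & {ae mu, forall x, A x -> `|f x| <= M}.
Proof.
move=> mA; rewrite /in_Lp inE => /andP[_]; rewrite inE /= /finite_norm unlock.
(* The norm for exponent +oo takes the value 0 by convention when the whole space is null; in that
   case any bound holds almost everywhere. *)
case: ifPn => [_ fy|]; last first.
  rewrite lt0e measure_ge0 andbT negbK => /eqP mu0; exists 0 => //.
  by exists setT; split.
have [M fM] := ess_supr_bounded (f := fun x => `|(f \_ A) x|) fy.
exists (Num.max 0 M); first by rewrite le_max lexx.
apply: filterS fM => x /= + Ax; rewrite patchE mem_set// le_max => ->.
by rewrite orbT.
Qed.

Lemma L2_ae_bounded A f (M : R) : measurable A -> (mu A < +oo)%E -> measurable_fun A f ->
  {ae mu, forall x, A x -> `|f x| <= M} -> L2 mu A f.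
Proof.
move=> mA Afin mf fM; split => //; apply/integrableP; split.
  by apply: measurableT_comp => //; exact: measurable_funX.
apply: (@le_lt_trans _ _ (\int[mu]_(x in A) ((M ^+ 2)%:E))%E); last first.
  by rewrite integral_cst// lte_mul_pinfty// lee_fin sqr_ge0.
apply: ae_ge0_le_integral => //.
- by do 2 apply: measurableT_comp => //; exact: measurable_funX.
- by move=> x _; rewrite lee_fin sqr_ge0.
- apply: filterS fM => x + Ax => /(_ Ax) fx /=.
  by rewrite lee_fin normrX ler_sqr ?nnegrE// (le_trans _ fx).
Qed.

(** Products of several L^2 functions need not be square integrable; here the essential bounds
    multiply, off a finite union of null sets. *)
Lemma prod_ae_bounded_L2 A m (u : 'I_m -> 'rV[R]_n -> R) (c : R) : measurable A ->
  (mu A < +oo)%E -> (forall j, measurable_fun A (u j)) ->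
  (forall j, in_Lp +oo%E A (u j)) -> L2 mu A (fun x => c * \prod_(j < m) u j x).
Proof.
move=> mA Afin mu_ uy.
have bu j : {M : R | 0 <= M /\ {ae mu, forall x, A x -> `|u j x| <= M}}.
  by apply: cid; have [M M0 uM] := in_Lpy_ae_bounded mA (uy j); exists M.
apply: (@L2_ae_bounded _ _ (`|c| * \prod_(j < m) sval (bu j))) => //.
  apply: measurable_funM => //.
  by apply: measurable_prod => j _; exact: mu_.
have : {ae mu, forall x, forall j, A x -> `|u j x| <= sval (bu j)}.
  by apply: filter_forall => j; case: (svalP (bu j)).
apply: filterS => x uM Ax; rewrite normrM normr_prod ler_wpM2l//.
by apply: ler_prod => j _; rewrite normr_ge0 uM.
Qed.

Lemma Lp_norm_le A f g (p : nat) (I : R) : measurable A -> (0 < p)%N ->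
  measurable_fun A f -> mu.-integrable A (EFin \o g) ->
  {ae mu, forall x, A x -> `|f x| ^+ p <= g x} ->
  \int[mu]_(x in A) g x <= I -> 0 <= I ->
  (Lp_norm (p%:R)%:E A f <= (I `^ (p%:R)^-1)%:E)%E.
Proof.
move=> mA p0 mf ig fg gI I0; rewrite /Lp_norm unlock.
rewrite -poweR_EFin gt0_ler_poweR// ?in_itv/= ?leey ?andbT ?lee_fin//.
- by apply: integral_ge0 => x _; rewrite lee_fin powR_ge0.
have mg : measurable_fun A (EFin \o g) by exact: measurable_int ig.
have -> : (\int[mu]_x (`|(f \_ A) x| `^ p%:R)%:E =
    \int[mu]_(x in A) (`|f x| ^+ p)%:E)%E.
  rewrite [RHS]integral_mkcond; apply: eq_integral => x _.
  rewrite [RHS]patchE /= patchE; case: ifPn => _ /=; first by rewrite powR_mulrn.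
  by rewrite [X in `|X|](_ : _ = 0)// normr0 powR0// pnatr_eq0 -lt0n.
apply: (@le_trans _ _ (\int[mu]_(x in A) `|(g x)%:E|)%E).
  apply: ae_ge0_le_integral => //.
  - by apply: measurableT_comp => //; apply: measurable_funX; exact: measurableT_comp.
  - exact: measurableT_comp.
  - by apply: filterS fg => x + Ax => /(_ Ax) h; rewrite lee_fin (le_trans h)// ler_norm.
rewrite (ae_eq_integral (EFin \o g))//; last 2 first.
- exact: measurableT_comp.
- apply: filterS fg => x + Ax => /(_ Ax) h; rewrite /= ger0_norm//.
  by rewrite (le_trans _ h)// exprn_ge0.
rewrite -[leLHS]fineK ?lee_fin//.
exact: integrable_fin_num.
Qed.

End bounded_ae.

(* The space is R^(n+1), the number of components is m = k+1, component 1 has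
   index ord0 and component i+1 has index lift ord0 i. *)
Theorem mainTheorem4 (R : realType) (n k : nat) (alpha : R)
  (Omega : set 'rV[R]_n.+1)
  (phi : 'I_k.+1 -> 'rV[R]_n.+1 -> R) (w : 'I_k -> 'rV[R]_n.+1 -> R)
  (halpha : 0 < alpha < 1)
  (hOmega : bounded_domain Omega)
  (hbdry : C1_holder_boundary alpha Omega)
  (hphi : forall i, C1_holder_bdry alpha Omega (phi i))
  (hphi_ge0 : forall i x, bdry Omega x -> 0 <= phi i x)
  (hphi_prod : forall x, bdry Omega x -> \prod_(i < k.+1) phi i x = 0)
  (hw : forall i, harmonic_on Omega (w i))
  (hw_cont : forall i, {within closure Omega, continuous (w i)})
  (hw_bdry : forall i x, bdry Omega x ->
     w i x = phi ord0 x - phi (lift ord0 i) x) :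
  exists C : R, forall (eps : R) (u : 'I_k.+1 -> 'rV[R]_n.+1 -> R),
    0 < eps -> segregation_solution Omega eps phi u ->
    (Lp_norm (k.+2%:R)%:E Omega (u ord0 \- max_plus w)%R
       <= (C * eps `^ (k.+2%:R)^-1)%:E)%E.
Proof.
have [oA _ _ bA] := hOmega.
have mA := measurable_open_rV oA; have Afin := bounded_lebesgue_rV oA bA.
have cw i : C1_on Omega (w i) by case: (hw i) => [[]].
(* A real-valued integral of a nonnegative measurable function that is not integrable defaults to 0,
   so [E] is known to be the true energy only when a solution exists, through [Ldw] below. *)
pose E := 2^-1 * \sum_(j < n.+1) \sum_(i < k)
  \int[lebesgue_rV n.+1]_(x in Omega) (partial j (w i) x ^+ 2).
have E0 : 0 <= E.
  rewrite mulr_ge0// sumr_ge0// => j _; rewrite sumr_ge0// => i _.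
  by apply: Rintegral_ge0 => x _; exact: sqr_ge0.
exists (E `^ (k.+2%:R)^-1) => eps u eps0 sol.
pose f x := eps^-1 * \prod_(j < k.+1) u j x.
have /choice[G HG] : forall i, exists G, H1_grad Omega (u i) G /\
    forall psi, test_fun Omega psi ->
    \sum_(j < n.+1) \int[lebesgue_rV n.+1]_(x in Omega) (G j x * partial j psi x) =
    - \int[lebesgue_rV n.+1]_(x in Omega) (f x * psi x).
  by move=> i; have [_ _ _ [G uG Gf] _] := sol i; exists G.
have Lu i : L2 (lebesgue_rV n.+1) Omega (u i) by case: (H1_grad_L2 oA (HG i).1).
have LG i j : L2 (lebesgue_rV n.+1) Omega (G i j) by case: (H1_grad_L2 oA (HG i).1).
have appu i : H1_approx Omega (u i) (G i) (phi i).
  by have [_ _ _ _ tr] := sol i; exact: trace_eq_approx (HG i).1 tr.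
have Lf : L2 (lebesgue_rV n.+1) Omega f.
  apply: prod_ae_bounded_L2 => // j; first by case: (Lu j).
  by case: (sol j).
(* All components have the same right-hand side, which cancels in the differences. *)
have vw i : {ae lebesgue_rV n.+1, forall x, Omega x ->
    u ord0 x - u (lift ord0 i) x = w i x}.
  apply: (weakly_harmonic_unique oA bA (G := fun j x => G ord0 j x - G (lift ord0 i) j x)
    (phi := fun x => phi ord0 x - phi (lift ord0 i) x)) => //.
  - exact: L2B.
  - by move=> j; exact: L2B.
  - exact: H1_approxB (HG _).1 (HG _).1 (appu _) (appu _).
  - move=> psi tpsi; have Ld j := test_fun_partial_L2 oA bA j tpsi.
    under eq_bigr => j _.
      under eq_Rintegral do rewrite mulrBl.
      rewrite RintegralB; [over|by []|exact: L2M|exact: L2M].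
    by rewrite sumrB (HG _).2// (HG _).2// subrr.
  - by move=> x bx; exact: hw_bdry.
(* Continuity up to the boundary gives no energy bound; finiteness comes from the weak gradient of
   u_1 - u_(i+1), which equals that of [w i]. *)
have Ldw i j : L2 (lebesgue_rV n.+1) Omega (partial j (w i)).
  have mdw : measurable_fun Omega (partial j (w i)).
    by apply: continuous_on_measurable => //; exact: C1_on_partial_continuous_on.
  apply: (@L2_ae_eq _ _ _ oA (fun x => G ord0 j x - G (lift ord0 i) j x)) => //.
    exact: L2B.
  apply: (weak_derivative_C1 oA bA (v := fun x => u ord0 x - u (lift ord0 i) x)) => //.
  - exact: L2B.
  - exact: L2B.
  - move=> psi tpsi; have Lp := test_fun_L2 oA bA tpsi.
    have Ld := test_fun_partial_L2 oA bA j tpsi.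
    under eq_Rintegral do rewrite mulrBl.
    under [in RHS]eq_Rintegral do rewrite mulrBl.
    rewrite !RintegralB//; try exact: L2M.
    have [[_ _ ->//] _] := HG ord0; have [[_ _ ->//] _] := HG (lift ord0 i).
    by rewrite opprD.
have wphi x : bdry Omega x -> max_plus w x = phi ord0 x.
  move=> bx; apply/eqP; rewrite eq_le; apply/andP; split.
    apply: max_plus_le; first exact: hphi_ge0.
    by move=> i; rewrite hw_bdry// gerBl hphi_ge0.
  (* Some component of the data vanishes. If it is the first, phi_1 = 0 is the floor of [max_plus];
     otherwise the corresponding w_j equals phi_1 there. *)
  have /eqP := hphi_prod x bx; rewrite prodf_seq_eq0 => /hasP[i _ /= /eqP phi0].
  have [j ij|i0] := unliftP ord0 i.
    by apply: le_trans (max_plus_ge w j x); rewrite hw_bdry// -ij phi0 subr0.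
  by rewrite -i0 phi0 max_plus_ge0.
have energy := reaction_energy_bound oA bA (Lu ord0) (LG ord0) Lf (appu ord0)
  (HG ord0).2 cw hw_cont wphi Ldw.
have LU := max_plus_L2 oA bA cw hw_cont.
rewrite -powRM// ?(ltW eps0)//.
have aeu : {ae lebesgue_rV n.+1, forall x, Omega x ->
    (forall i, 0 <= u i x) /\ forall i, u ord0 x - u (lift ord0 i) x = w i x}.
  have h1 : {ae lebesgue_rV n.+1, forall x, forall i, Omega x -> 0 <= u i x}.
    by apply: filter_forall => i; case: (sol i).
  have h2 : {ae lebesgue_rV n.+1, forall x, forall i, Omega x ->
    u ord0 x - u (lift ord0 i) x = w i x} by apply: filter_forall.
  by apply: filterS2 h1 h2 => x h1 h2 Ox; split => i; [exact: h1|exact: h2].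
apply: (@Lp_norm_le _ _ _ _ (fun x => eps * (f x * (u ord0 x - max_plus w x)))) => //.
- by case: (L2B mA (Lu ord0) LU).
- by apply: integrableZl_EFin => //; apply: L2M => //; exact: L2B.
- apply: filterS aeu => x + Ox => /(_ Ox)[u0 uw] /=.
  have Ule : max_plus w x <= u ord0 x.
    by apply: max_plus_le => // i; rewrite -uw gerBl.
  have d0 : 0 <= u ord0 x - max_plus w x by rewrite subr_ge0.
  (* For component i+1, u_1 - U <= u_1 - w_i = u_(i+1); for the first one, U >= 0. *)
  have dle j : u ord0 x - max_plus w x <= u j x.
    have [i ->|->] := unliftP ord0 j; last by rewrite gerBl max_plus_ge0.
    by have := max_plus_ge w i x; have := uw i; lra.
  (* [eps] cancels the factor [eps^-1] of [f]. Of the k+2 factors u_1 - U one is kept, and the other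
     k+1 are compared with the factors of the product. *)
  rewrite ger0_norm// /f mulrA mulrA mulfV ?gt_eqF// mul1r exprSr ler_wpM2r//.
  rewrite -[X in _ ^+ X]card_ord -prodr_const.
  by apply: ler_prod => j _; rewrite d0 dle.
- rewrite RintegralZl//; last by apply: L2M => //; exact: L2B.
  by rewrite mulrC ler_wpM2r// ltW.
- by rewrite mulr_ge0// ltW.
Qed.
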